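(* Let $b$ be a locally integrable (real-valued) function on $\mathbb{R}^n$, let $\mu\in A_1$ and $0<\beta<1$. Suppose that $1<p<n/\beta$ and $1/q=1/p-\beta/n$. Then the following assertions are equivalent: (1) $b\in Lip_{\beta,\mu}$ and $b\ge0$ a.e. in $\mathbb{R}^n$. (2) The nonlinear commutator $[b,M]$ is bounded from $L^p(\mu)$ to $L^q(\mu^{1-q})$. (3) There exists a constant $C>0$ such that $$\sup_Q\frac1{\mu(Q)^{\beta/n}}\left(\frac1{\mu(Q)}\int_Q|b(x)-M_Q(b)(x)|^q\mu(x)^{1-q}\,dx\right)^{1/q}\le C,$$ where the supremum is taken over all cubes $Q\subset\mathbb{R}^n$.
   Context: Cubes $Q\subset\mathbb{R}^n$ have sides parallel to the coordinate axes; $|Q|$ is Lebesgue measure; $f_Q=|Q|^{-1}\int_Q f(x)\,dx$. A weight is a nonnegative locally integrable function on $\mathbb{R}^n$, not a.e. equal to zero; $\mu(E)=\int_E\mu(x)\,dx$ and $\|f\|_{L^p(\mu)}=\left(\int_{\mathbb{R}^n}|f(x)|^p\mu(x)\,dx\right)^{1/p}$. The Hardy–Littlewood maximal function is $M(f)(x)=\sup_{Q\ni x}\frac1{|Q|}\int_Q|f(y)|\,dy$ (supremum over all cubes containing $x$). $A_1$ is the Muckenhoupt class: $\mu\in A_1$ if there is a constant $C$ with $M(\mu)(x)\le C\mu(x)$ for a.e. $x$. For a cube $Q_0$ and $x\in Q_0$, $M_{Q_0}(f)(x)=\sup_{Q_0\supseteq Q\ni x}\frac1{|Q|}\int_Q|f(y)|\,dy$,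 the supremum being over all cubes $Q$ with $x\in Q\subseteq Q_0$. The nonlinear commutator of $M$ and $b$ is $[b,M](f)(x)=b(x)M(f)(x)-M(bf)(x)$. The weighted Lipschitz space $Lip_{\beta,\mu}$ is the set of $f\in L^1_{\mathrm{loc}}(\mathbb{R}^n)$ such that $$\|f\|_{Lip_{\beta,\mu}}=\sup_Q\frac1{\mu(Q)^{1+\beta/n}}\int_Q|f(x)-f_Q|\,dx<\infty,$$ the supremum being over all cubes $Q\subset\mathbb{R}^n$. An operator $T$ (not necessarily linear or sublinear) is bounded from $L^p(\mu)$ to $L^q(\mu^{1-q})$ if there is a constant $C>0$ such that, for every $f\in L^p(\mu)$, $Tf$ is defined a.e. and $\|Tf\|_{L^q(\mu^{1-q})}\le C\|f\|_{L^p(\mu)}$. *)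

(* Defs.v *)
From HB Require Import structures.
From mathcomp Require Import all_boot all_order all_algebra.
From mathcomp Require Import all_classical all_reals all_analysis.

Set Implicit Arguments.
Unset Strict Implicit.
Unset Printing Implicit Defensive.

Import Order.TTheory GRing.Theory Num.Theory.
Import numFieldNormedType.Exports.

Local Open Scope classical_set_scope.
Local Open Scope ring_scope.

(* The ambient space is 'rV[R]_n.+1: the dimension n.+1 ranges over all positive
   integers, and dimension 0 is excluded. *)

Section lebesgue_outer_measure.
Context {R : realType} {n : nat}.
Local Notation V := 'rV[R]_n.+1.

(* A pair (a, b) encodes the closed box with opposite corners a <= b. *)
Definition is_box (B : V * V) := forall i, B.1 ord0 i <= B.2 ord0 i.

Definition box (B : V * V) : set V :=
  [set x | forall i, B.1 ord0 i <= x ord0 i <= B.2 ord0 i].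

Definition box_volume (B : V * V) : R := \prod_i (B.2 ord0 i - B.1 ord0 i).

Definition box_cover (A : set V) : set (nat -> V * V) :=
  [set B | (forall k, is_box (B k)) /\ A `<=` \bigcup_k box (B k)].

Definition lebesgue_outer (A : set V) : \bar R :=
  ereal_inf [set (\sum_(0 <= k <oo) (box_volume (B k))%:E)%E |
             B in box_cover A].

Lemma box_volume_ge0 (B : V * V) : is_box B -> 0 <= box_volume B.
Proof. by move=> hB; apply: prodr_ge0 => i _; rewrite subr_ge0. Qed.

Local Open Scope ereal_scope.

Lemma lebesgue_outer_ge0 (A : set V) : 0 <= lebesgue_outer A.
Proof.
apply: le_ereal_inf_tmp => _ [B [hB _] <-]; apply: nneseries_ge0 => k _ _.
by rewrite lee_fin box_volume_ge0.
Qed.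

Lemma lebesgue_outer0 : lebesgue_outer set0 = 0.
Proof.
apply/eqP; rewrite eq_le lebesgue_outer_ge0 andbT.
apply: ereal_inf_lbound; exists (fun=> (0, 0)%R).
  by split => // k i; rewrite lexx.
rewrite eseries0// => k _ _.
by rewrite /box_volume big_ord_recl/= !mxE subrr mul0r.
Qed.

Lemma le_lebesgue_outer :
  {homo lebesgue_outer : A B / A `<=` B >-> A <= B}.
Proof.
move=> A B AB; apply: ereal_inf_le_tmp => _ [C [hC BC] <-].
by exists C => //; split=> //; exact: subset_trans BC.
Qed.

Lemma lebesgue_outer_sigma_subadditive : sigma_subadditive lebesgue_outer.
Proof.
move=> A; have [[i ioo]|] := pselect (exists i, lebesgue_outer (A i) = +oo).
  rewrite (eseries_pinfty _ _ ioo) ?leey// => k _.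
  by rewrite -ltNye (lt_le_trans _ (lebesgue_outer_ge0 _)).
rewrite -forallNE => Aoo.
suff add2e (e : {posnum R}) : lebesgue_outer (\bigcup_k A k) <=
    \sum_(i <oo) lebesgue_outer (A i) + e%:num%:E.
  by apply/lee_addgt0Pr => _/posnumP[].
rewrite (le_trans _ (epsilon_trick _ _ _))//; last first.
  by move=> k; exact: lebesgue_outer_ge0.
pose P k (B : nat -> V * V) := box_cover (A k) B /\
  \sum_(0 <= j <oo) (box_volume (B j))%:E <=
    lebesgue_outer (A k) + (e%:num / (2 ^ k.+1)%:R)%:E.
have [G PG] : {G : nat -> nat -> V * V & forall k, P k (G k)}.
  apply: (@choice _ _ P) => k.
  have fA : lebesgue_outer (A k) \is a fin_num.
    by rewrite ge0_fin_numE ?lebesgue_outer_ge0// ltey; apply/eqP/Aoo.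
  have ek : (0 < e%:num / (2 ^ k.+1)%:R :> R)%R by [].
  have [_ [B cB <-] ltB] := lb_ereal_inf_adherent ek fA.
  by exists B; split => //; exact: ltW.
pose v (p : nat * nat) := (box_volume (G p.1 p.2))%:E : \bar R.
have v_ge0 p : 0 <= v p.
  by rewrite lee_fin; apply: box_volume_ge0; exact: (PG p.1).1.1.
apply: (@le_trans _ _ (\esum_(p in setT) v p)).
  apply: ereal_inf_lbound => /=.
  have /card_esym/ppcard_eqP[f] := card_nat2.
  exists (uncurry G \o f).
    split => [k /=|]; first by case: (f k) => i j /=; exact: (PG i).1.1.
    move=> t [i _ /(PG i).1.2[j _ Gt]].
    by exists (f^-1%FUN (i, j)) => //=; rewrite invK ?inE.
  rewrite (@eq_eseriesr _ _ (v \o f)) => [|k _]; last first.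
    by rewrite /v/=; case: (f k).
  rewrite -(esum_pred_image v f xpredT) ?[fun=> _]set_true//.
  by rewrite image_eq.
rewrite (_ : esum _ _ = \sum_(i <oo) \sum_(j <oo) v (i, j)); last first.
  pose J : nat -> set (nat * nat) := fun i => [set (i, j) | j in setT].
  rewrite (_ : setT = \bigcup_k J k); last first.
    by rewrite predeqE => -[a b]; split => // _; exists a => //; exists b.
  rewrite esum_bigcupT /=; last 2 first.
    - apply/trivIsetP => i j _ _ ij.
      rewrite predeqE => -[k m] /=; split => //= -[] [_] _ [<-{k} _].
      by move=> [m' _] [] /esym/eqP; rewrite (negbTE ij).
    - by move=> p; exact: v_ge0.
  rewrite -(image_id [set: nat]) -fun_true esum_pred_image//; last first.
    by move=> k _; apply: esum_ge0.
  apply: eq_eseriesr => /= j _.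
  rewrite -(esum_pred_image v (pair j) predT)//=; last first.
    by move=> ? ? _ _; exact: (@can_inj _ _ _ snd).
  by congr esum; rewrite predeqE => -[a b]; split; move=> [i _ <-]; exists i.
apply: lee_nneseries => // k _; last by have [] := PG k.
by move=> *; apply: nneseries_ge0 => j _ _; exact: v_ge0.
Qed.

HB.instance Definition _ := isOuterMeasure.Build R V lebesgue_outer
  lebesgue_outer0 lebesgue_outer_ge0 le_lebesgue_outer
  lebesgue_outer_sigma_subadditive.

End lebesgue_outer_measure.

(* R^(n+1) equipped with the sigma-algebra of Lebesgue measurable sets. *)
Definition Rn (R : realType) (n : nat) :=
  caratheodory_type (@lebesgue_outer R n).

HB.instance Definition _ R n := Measurable.on (Rn R n).

Definition lebn (R : realType) (n : nat) : set (Rn R n) -> \bar R :=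
  @lebesgue_outer R n.

HB.instance Definition _ R n := isMeasure.Build _ (Rn R n) R (@lebn R n)
  (caratheodory_measure0 (@lebesgue_outer R n))
  (@caratheodory_measure_ge0 _ _ (@lebesgue_outer R n))
  (caratheodory_measure_sigma_additive (mu := @lebesgue_outer R n)).

Section weighted_spaces.
Context {R : realType} {n : nat}.
Local Notation T := (Rn R n).
Local Notation leb := (@lebn R n).
Local Notation dim := (n.+1%:R : R).

(* Closed cube with lower corner a and side length l. *)
Definition cube (a : 'rV[R]_n.+1) (l : R) : set T :=
  [set x : 'rV[R]_n.+1 | forall i, a ord0 i <= x ord0 i <= a ord0 i + l].

Definition is_cube (Q : set T) := exists a l, 0 < l /\ Q = cube a l.

Local Open Scope ereal_scope.

Definition locally_integrable_n (f : T -> R) :=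
  measurable_fun setT f /\
  forall K : set 'rV[R]_n.+1, compact K ->
    \int[leb]_(x in (K : set T)) `|f x|%:E < +oo.

Definition is_weight (mu : T -> R) :=
  [/\ locally_integrable_n mu, (forall x, 0 <= mu x)%R &
      ~ {ae leb, forall x, mu x = 0%R}].

Definition weight_measure (mu : T -> R) (E : set T) : \bar R :=
  \int[leb]_(x in E) (mu x)%:E.

Definition weighted_norm (p : R) (w : T -> R) (f : T -> \bar R) : \bar R :=
  (\int[leb]_x (`|f x| `^ p * (w x)%:E)) `^ p^-1.

Definition weighted_L (p : R) (w : T -> R) (f : T -> R) :=
  measurable_fun setT f /\ weighted_norm p w (EFin \o f) < +oo.

Definition cube_mean (f : T -> R) (Q : set T) : R :=
  (fine (leb Q))^-1 * \int[leb]_(x in Q) f x.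

Definition cube_abs_mean (f : T -> R) (Q : set T) : \bar R :=
  (leb Q)^-1 * \int[leb]_(y in Q) `|f y|%:E.

Definition maximal (f : T -> R) (x : T) : \bar R :=
  ereal_sup [set cube_abs_mean f Q | Q in [set Q | is_cube Q /\ Q x]].

Definition local_maximal (Q0 : set T) (f : T -> R) (x : T) : \bar R :=
  ereal_sup [set cube_abs_mean f Q |
             Q in [set Q | [/\ is_cube Q, Q x & Q `<=` Q0]]].

Definition muckenhoupt_A1 (mu : T -> R) :=
  is_weight mu /\
  exists C : R, {ae leb, forall x, maximal mu x <= C%:E * (mu x)%:E}.

Definition commutator_maximal (b f : T -> R) (x : T) : \bar R :=
  (b x)%:E * maximal f x - maximal (fun y => b y * f y)%R x.

Definition lip_seminorm (beta : R) (mu f : T -> R) : \bar R :=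
  ereal_sup [set (weight_measure mu Q `^ (1 + beta / dim))^-1 *
                 \int[leb]_(x in Q) `|f x - cube_mean f Q|%:E |
             Q in is_cube].

Definition weighted_lip (beta : R) (mu f : T -> R) :=
  locally_integrable_n f /\ lip_seminorm beta mu f < +oo.

(* Values of the operator are extended reals, and "S f is defined at x" means
   that S f x is finite.  As oo - oo is infinite by convention, this makes
   [b, M] f defined at x only if both terms of the difference are finite. *)
Definition bounded_operator (S : (T -> R) -> T -> \bar R)
    (p : R) (w : T -> R) (q : R) (w' : T -> R) :=
  exists C : R, (0 < C)%R /\
    forall f, weighted_L p w f ->
      {ae leb, forall x, S f x \is a fin_num} /\
      weighted_norm q w' (S f) <= C%:E * weighted_norm p w (EFin \o f).

End weighted_spaces.

(* Main.v *)
Require Import Defs.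
From mathcomp Require Import all_boot all_order all_algebra.
From mathcomp Require Import all_classical all_reals all_analysis.
From mathcomp Require Import measurable_realfun ring lra.

Set Implicit Arguments.
Unset Strict Implicit.
Unset Printing Implicit Defensive.

Import Order.TTheory GRing.Theory Num.Theory.
Import numFieldNormedType.Exports.

Local Open Scope classical_set_scope.
Local Open Scope ring_scope.

(* The commutator is controlled by deviations of b. By A_1, mu charges a subset
   of a cube at least in proportion to its volume; hence mu is doubling, and
   reverse doubling with a ratio < 1 when a cube is halved.

   (1) => (2). Telescoping over cubes shrinking to x, reverse doubling gives
   |b(x) - b_Q| <= D mu(x) mu(Q)^(beta/n) for a.e. x and all cubes Q containing
   x. With b >= 0, |[b, M] f (x)| is then at most a constant times mu(x) times
   the supremum of mu(Q)^(beta/n - 1) \int_Q |f| mu, which Hedberg's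
   interpolation bounds by ||f||^(p beta/n) (M_mu f)^(p/q), where M_mu is the
   maximal function of the measure mu, bounded on L^p(mu).

   (2) => (3). On Q, M(1_Q) = 1 and M(b 1_Q) = M_Q(b): test on f = 1_Q.

   (3) => (1). On Q, M_Q(b) dominates both b_Q and |b|_Q, so (3) bounds the
   integral over Q of the positive parts of b_Q - b and of |b|_Q - b by
   C mu(Q)^(1 + beta/n). The first is half the oscillation of b. The second
   dominates the integral of |b| - b over Q, which therefore vanishes.

   No differentiation theorem is needed: every cube has covers by arbitrarily
   small cubes with the sum of mu(Q)^(1 + beta/n) as small as desired. *)

(** Write al = beta/n. The target weight absorbs the factor mu(x) of the pointwise bound, (mu(x)
    s)^q mu(x)^(1-q) = s^q mu(x), and the relation between p and q reads 1 - p al = p/q, so the q-th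
    power of the interpolated bound is a power of the norm of f times (M_mu f)^p mu. Nonnegativity
    of b enters because M only sees |b f|: averages of |b f| over cubes containing x are comparable
    with b(x) times those of |f| when b(x) = |b(x)|. The A_1 inequality is used at two kinds of
    points: at the points of integration, to bound plain averages of |f| by weighted ones, and at x,
    to bound mu(Q)/|Q| by a multiple of mu(x), which is where the factor mu(x) comes from. The main
    obstacle is that integrals of maximal functions can only be handled by monotonicity. So the L^p
    bound for M_mu is carried by a measurable majorant, a series over dyadic levels of indicators of
    countable unions of rational cubes, and the covering arguments are reduced to finite lists of
    cubes. *)

(* [maximal] and [local_maximal] are never shown to be measurable: the integral,
   a supremum over simple functions, is monotone all the same. *)
Lemma le_integral_nonmeasurable d (T : measurableType d) (R : realType)
    (nu : {measure set T -> \bar R}) (D : set T) (f g : T -> \bar R) :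
  (forall x, D x -> 0 <= f x)%E -> (forall x, D x -> f x <= g x)%E ->
  (\int[nu]_(x in D) f x <= \int[nu]_(x in D) g x)%E.
Proof.
move=> f0 fg; have g0 x : D x -> (0 <= g x)%E.
  by move=> Dx; exact: le_trans (f0 _ Dx) (fg _ Dx).
rewrite integral_mkcond [leRHS]integral_mkcond.
rewrite !ge0_integralTE; last 2 first.
- by move=> x; rewrite erestrict_ge0.
- by move=> x; rewrite erestrict_ge0.
apply: ereal_sup_le => _ [h hf <-]; exists h => // x.
apply: le_trans (hf x) _; rewrite /patch; case: ifPn => // /set_mem Dx.
exact: fg.
Qed.

(** * Lebesgue measure of cubes *)

Section lebesgue_cubes.
Context {R : realType} {n : nat}.
Local Notation V := 'rV[R]_n.+1.
Local Notation T := (Rn R n).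
Local Notation leb := (@lebn R n).

(** Cutting every box of a cover by the hyperplane x_i = c splits its volume exactly. The two
    hypotheses leave the hyperplane itself unassigned, so the open and the closed half-space are
    handled at once. *)
Lemma split_caratheodory (i : 'I_n.+1) (c : R) (H : set V) :
  (forall x : V, x ord0 i < c -> H x) -> (forall x : V, H x -> x ord0 i <= c) ->
  (@lebesgue_outer R n).-caratheodory H.
Proof.
move=> H1 H2; apply: le_caratheodory_measurable => X.
apply: le_ereal_inf_tmp => _ [B [hB XB] <-].
(* The cut [c] is clamped to the i-th side of the box, so that both pieces are boxes even if the
   hyperplane misses the box; one of them is then flat. *)
pose c' k := Num.max ((B k).1 ord0 i) (Num.min c ((B k).2 ord0 i)).
have c'P k : (B k).1 ord0 i <= c' k <= (B k).2 ord0 i.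
  rewrite /c' le_max lexx/= ge_max (hB k i)/=.
  by rewrite ge_min lexx orbT.
pose lo k : V * V :=
  ((B k).1, \row_j if j == i then c' k else (B k).2 ord0 j).
pose hi k : V * V :=
  (\row_j (if j == i then c' k else (B k).1 ord0 j), (B k).2).
have lo_box k : is_box (lo k).
  move=> j; rewrite /lo/= mxE; case: eqP => [->|_]; last exact: hB.
  by case/andP: (c'P k).
have hi_box k : is_box (hi k).
  move=> j; rewrite /hi/= mxE; case: eqP => [->|_]; last exact: hB.
  by case/andP: (c'P k).
have vol k : box_volume (B k) = box_volume (lo k) + box_volume (hi k).
  pose P := \prod_(j | j != i) ((B k).2 ord0 j - (B k).1 ord0 j).
  have -> : box_volume (lo k) = (c' k - (B k).1 ord0 i) * P.
    rewrite /box_volume (bigD1 i)//= mxE eqxx; congr (_ * _).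
    by apply: eq_bigr => j /negbTE ji; rewrite mxE ji.
  have -> : box_volume (hi k) = ((B k).2 ord0 i - c' k) * P.
    rewrite /box_volume (bigD1 i)//= mxE eqxx; congr (_ * _).
    by apply: eq_bigr => j /negbTE ji; rewrite mxE ji.
  by rewrite /box_volume (bigD1 i)//= -mulrDl; congr (_ * _); ring.
apply: (@le_trans _ _ (\sum_(0 <= k <oo) (box_volume (lo k))%:E +
                       \sum_(0 <= k <oo) (box_volume (hi k))%:E)%E).
  apply: leeD; apply: ereal_inf_lbound.
    exists lo => //; split=> // x [Xx Hx]; have [k _ Bx] := XB _ Xx.
    exists k => // j; rewrite /lo/= mxE; case: eqP => [->|_]; last exact: Bx.
    have /andP[Bx1 Bx2] := Bx i; rewrite Bx1/= /c' le_max le_min Bx2 andbT.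
    by rewrite (H2 _ Hx) orbT.
  exists hi => //; split=> // x [Xx Hx]; have [k _ Bx] := XB _ Xx.
  exists k => // j; rewrite /hi/= mxE; case: eqP => [->|_]; last exact: Bx.
  have /andP[Bx1 Bx2] := Bx i; rewrite Bx2 andbT /c' ge_max Bx1/= ge_min.
  by rewrite leNgt; apply/orP; left; apply/negP => /H1.
rewrite -nneseriesD; last 2 first.
- by move=> k _ _; rewrite lee_fin box_volume_ge0.
- by move=> k _ _; rewrite lee_fin box_volume_ge0.
by rewrite (@eq_eseriesr _ _ (fun k => (box_volume (B k))%:E))// => k _;
  rewrite vol EFinD.
Qed.

Lemma measurable_cube (a : V) (l : R) : measurable (cube a l).
Proof.
have -> : cube a l = \bigcap_(i in [set: 'I_n.+1])
    ((~` [set x : V | x ord0 i < a ord0 i]) `&`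
     [set x : V | x ord0 i <= a ord0 i + l]) :> set T.
  apply/seteqP; split=> [x xa i _|x xa i].
    by have /andP[? ?] := xa i; split=> //=; apply/negP; rewrite -leNgt.
  have /= [/negP] := xa i I.
  by rewrite -leNgt => ? ?; apply/andP; split.
apply: fin_bigcap_measurable => // i _; apply: measurableI.
  apply: measurableC; apply: (@split_caratheodory i (a ord0 i)) => //= x.
  exact: ltW.
by apply: (@split_caratheodory i (a ord0 i + l)) => //= x; exact: ltW.
Qed.

Lemma compact_cube (a : V) (l : R) : compact (cube a l : set V).
Proof.
have -> : (cube a l : set V) =
    [set v | forall i, [set` `[a ord0 i, a ord0 i + l]] (v ord0 i)].
  by apply/seteqP; split=> x xa i; have := xa i; rewrite /= in_itv/=.
apply: (@rV_compact R n.+1 (fun i => [set` `[a ord0 i, a ord0 i + l]])) => i.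
exact: segment_compact.
Qed.

(** The affine map [f] of ratio r = l / l' carries a cover of the second cube to a cover of the
    first and multiplies volumes by r^(n+1). Used in both directions, the inequality gives the exact
    scaling law of [lebn_cube]. *)
Lemma lebn_cube_le (a a' : V) (l l' : R) : 0 < l -> 0 < l' ->
  (leb (cube a l) <= ((l / l') ^+ n.+1)%:E * leb (cube a' l'))%E.
Proof.
move=> l0 l'0; set r := l / l'.
have r0 : 0 < r by rewrite divr_gt0.
rewrite muleC -lee_pdivrMr ?exprn_gt0//.
apply: le_ereal_inf_tmp => _ [B [hB QB] <-].
rewrite lee_pdivrMr ?exprn_gt0// muleC -nneseriesZl; last 1 first.
- by move=> k _; rewrite lee_fin box_volume_ge0.
pose f (x : V) : V := \row_j (a ord0 j + r * (x ord0 j - a' ord0 j)).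
apply: ereal_inf_lbound.
exists (fun k => (f (B k).1, f (B k).2)).
  split=> [k i|x Qx]; first by rewrite !mxE lerD2l ler_pM2l// lerD2r hB.
  pose y : V := \row_j (a' ord0 j + r^-1 * (x ord0 j - a ord0 j)).
  have Qy : cube a' l' y.
    move=> i; rewrite mxE; have /andP[x1 x2] := Qx i.
    rewrite lerDl lerD2l mulr_ge0 ?invr_ge0 ?(ltW r0) ?subr_ge0//=.
    by rewrite ler_pdivrMl// /r divfK ?gt_eqF// lerBlDl.
  have [k _ By] := QB y Qy; exists k => // i; have /andP[] := By i.
  rewrite !mxE => y1 y2.
  have -> : x ord0 i = a ord0 i + r * (y ord0 i - a' ord0 i).
    rewrite mxE; field; exact: lt0r_neq0.
  by rewrite !lerD2l !ler_pM2l// !lerD2r mxE y1 y2.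
apply: eq_eseriesr => k _; rewrite -EFinM; congr EFin.
have -> : r ^+ n.+1 = \prod_(i < n.+1) r by rewrite prodr_const card_ord.
rewrite /box_volume -big_split/=.
by apply: eq_bigr => i _; rewrite !mxE; ring.
Qed.

(* That this is 1 is not needed; that it is positive follows from the existence
   of a weight. *)
Definition unit_volume : R := fine (leb (cube 0 1)).

Lemma lebn_cube (a : V) (l : R) : 0 < l ->
  leb (cube a l) = (unit_volume * l ^+ n.+1)%:E.
Proof.
move=> l0.
have u_fin : leb (cube 0 1) \is a fin_num.
  rewrite ge0_fin_numE ?measure_ge0//.
  (* One box of volume 1 followed by flat boxes: a cover of finite total volume. *)
  pose B k : V * V := if k == 0%N then (0, const_mx 1) else (0, 0).
  apply: (@le_lt_trans _ _ (\sum_(0 <= k <oo) (box_volume (B k))%:E)%E).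
    apply: ereal_inf_lbound; exists B => //.
    split=> [k i|x Qx]; first by rewrite /B; case: ifPn => _; rewrite !mxE.
    by exists 0%N => // i; have := Qx i; rewrite /= !mxE add0r.
  have B0 k : (0 <= (box_volume (B k))%:E)%E.
    by rewrite lee_fin box_volume_ge0// => i; rewrite /B; case: ifPn => _;
      rewrite !mxE.
  rewrite nneseries_recl// eseries0 ?adde0 ?ltry// => -[//|k] _ _.
  by rewrite /B/= /box_volume big_ord_recl/= !mxE subrr mul0r.
rewrite mulrC EFinM fineK//; apply/eqP; rewrite eq_le; apply/andP; split.
  by have := lebn_cube_le a 0 l0 ltr01; rewrite divr1.
have := lebn_cube_le 0 a ltr01 l0.
by rewrite div1r exprVn lee_pdivlMl ?exprn_gt0.
Qed.

Lemma unit_volume_ge0 : 0 <= unit_volume.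
Proof. exact: fine_ge0. Qed.

(** Completeness of the Caratheodory measure: a set of outer measure zero is measurable, so it is
    its own null cover. *)
Lemma lebn0_negligible (A : set T) : leb A = 0%E -> leb.-negligible A.
Proof.
move=> A0; exists A; split => //.
apply: (@le_caratheodory_measurable _ _ (@lebesgue_outer R n)) => X.
rewrite -[leRHS]add0e; apply: leeD; last exact: le_lebesgue_outer.
by rewrite -A0; apply: le_lebesgue_outer.
Qed.

Lemma le_lebn (A B : set T) : A `<=` B -> (leb A <= leb B)%E.
Proof. exact: le_lebesgue_outer. Qed.

Definition centered_cube (k : nat) : set T :=
  cube (const_mx (- k.+1%:R)) (k.+1%:R *+ 2).

Lemma bigcup_centered_cube : \bigcup_k centered_cube k = setT.
Proof.
apply/seteqP; split=> // x _; pose m := \big[Num.max/0]_i `|(x : V) ord0 i|.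
have [k mk] : exists k, m < k.+1%:R.
  exists (Num.bound m); apply: lt_trans (archi_boundP _) _.
    by apply: bigmax_ge_id.
  by rewrite ltr_nat.
exists k => // i; rewrite mxE mulr2n addrA addNr add0r -ler_norml.
by apply: le_trans (ltW mk); apply: le_bigmax.
Qed.

Lemma negligible_centered_cube (A : set T) :
  (forall k, leb (A `&` centered_cube k) = 0%E) -> leb.-negligible A.
Proof.
move=> A0; rewrite -[A]setIT -bigcup_centered_cube setI_bigcupr.
by apply: negligible_bigcup => k; apply: lebn0_negligible.
Qed.

(** To be contradicted: a null unit cube would make every set negligible, while a weight is not
    almost everywhere zero. *)
Lemma lebn_negligible (A : set T) : unit_volume = 0 -> leb.-negligible A.
Proof.
move=> u0; apply: negligible_centered_cube => k.
apply/eqP; rewrite eq_le outer_measure_ge0 andbT.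
apply: le_trans (le_lebn (@subIsetr _ _ _)) _.
by rewrite lebn_cube ?u0 ?mul0r// pmulrn_lgt0.
Qed.

End lebesgue_cubes.

(** * Vitali's covering lemma for finitely many cubes *)

Section vitali.
Context {R : realType} {n : nat}.
Local Notation V := 'rV[R]_n.+1.
Local Notation T := (Rn R n).
Local Notation leb := (@lebn R n).

(** The concentric cube of three times the side: the lower corner moves by one side length in every
    coordinate. *)
Definition tripled (c : V * R) : V * R := (c.1 - const_mx c.2, c.2 *+ 3).

Local Notation cubep c := (cube c.1 c.2 : set T).

Lemma cube_nonempty (a : V) (l : R) : 0 < l -> (cube a l : set T) a.
Proof. by move=> l0 i; rewrite lexx lerDl ltW. Qed.

Lemma sub_tripled (c c' : V * R) : c.2 <= c'.2 ->
  cubep c `&` cubep c' !=set0 -> cubep c `<=` cubep (tripled c').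
Proof.
move=> ll [y [cy c'y]] x cx i; rewrite /= !mxE.
have := cx i; have := cy i; have := c'y i; move: ll.
rewrite -mulr_natr; lra.
Qed.

Lemma exists_largest (s : seq (V * R)) (c1 : V * R) :
  exists2 c0, c0 \in c1 :: s & forall c, c \in c1 :: s -> c.2 <= c0.2.
Proof.
elim: s c1 => [|c2 s ih] c1.
  by exists c1; rewrite ?inE// => c; rewrite inE => /eqP ->.
have [c0 c0s c0max] := ih c2; have [le|lt] := leP c1.2 c0.2.
  exists c0; first by rewrite inE c0s orbT.
  by move=> c; rewrite inE => /predU1P[->//|/c0max].
exists c1; first by rewrite inE eqxx.
move=> c; rewrite inE => /predU1P[->//|/c0max cc0].
exact: le_trans cc0 (ltW lt).
Qed.

(** Greedy selection: a largest cube [c0] is kept, the cubes meeting it lie in [tripled c0] and are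
    discarded, and the rest is treated by induction on the length. Disjointness is stated with
    [count], so that sums of indicators over the list are at most 1 and repeated entries are
    excluded. *)
Lemma vitali_cubes (s : seq (V * R)) : (forall c, c \in s -> 0 < c.2) ->
  exists s' : seq (V * R), [/\ {subset s' <= s},
    forall x : T, (count (fun c => x \in cubep c) s' <= 1)%N &
    forall c, c \in s -> exists2 c', c' \in s' & cubep c `<=` cubep (tripled c')].
Proof.
have [m] := ubnP (size s); elim: m s => // m ih [|c1 s] sm s_gt0.
  by exists [::]; split.
have [c0 c0s c0max] := exists_largest s c1.
pose meets c := `[< cubep c `&` cubep c0 !=set0 >].
pose s1 := [seq c <- c1 :: s | ~~ meets c].
have c0c0 : meets c0.
  by apply/asboolP; exists c0.1; split; apply: cube_nonempty; exact: s_gt0.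
have s1m : (size s1 < m)%N.
  rewrite ltnS in sm; apply: leq_trans sm.
  rewrite size_filter -(count_predC meets (c1 :: s)) -[ltnLHS]add0n ltn_add2r.
  by rewrite -has_count; apply/hasP; exists c0.
have [|s' [s's ds' cs']] := ih s1 s1m.
  by move=> c; rewrite mem_filter => /andP[_]; exact: s_gt0.
exists (c0 :: s'); split.
- move=> c; rewrite inE => /predU1P[->//|/s's].
  by rewrite mem_filter => /andP[].
- move=> x /=; case: (boolP (x \in cubep c0)) => [|_]; last exact: ds'.
  move=> /set_mem c0x; rewrite [X in (_ + X)%N](_ : _ = 0%N)//.
  apply/eqP; rewrite eqn0Ngt -has_count; apply/hasPn => c /s's.
  rewrite mem_filter => /andP[/negP mc _]; apply/negP => /set_mem cx.
  by apply: mc; apply/asboolP; exists x.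
- move=> c cs; have [mc|mc] := boolP (meets c).
    exists c0; first by rewrite inE eqxx.
    by apply: sub_tripled; [exact: c0max|exact/asboolP].
  have [|c' c's' cc'] := cs' c; first by rewrite mem_filter mc.
  by exists c' => //; rewrite inE c's' orbT.
Qed.

Lemma sum_integral_cubes (B : set T) (h : T -> \bar R) (s : seq (V * R)) :
  measurable B -> measurable_fun B h -> (forall x, B x -> 0 <= h x)%E ->
  (forall c, c \in s -> cubep c `<=` B) ->
  (forall x : T, (count (fun c => x \in cubep c) s <= 1)%N) ->
  (\sum_(c <- s) \int[leb]_(x in cubep c) h x <= \int[leb]_(x in B) h x)%E.
Proof.
move=> mB mh h0 sB ds.
have mhc c : measurable_fun B (h \_ (cubep c)).
  by apply/(measurable_restrict _ _ _) => //;
    [exact: measurable_cube|apply: measurable_funS mh].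
have hc0 c x : B x -> (0 <= (h \_ (cubep c)) x)%E.
  by move=> Bx; rewrite /patch; case: ifPn => // _; exact: h0.
rewrite big_seq (eq_bigr (fun c => \int[leb]_(x in B) (h \_ (cubep c)) x)%E).
  rewrite -big_seq -ge0_integral_sum//.
  apply: le_integral_nonmeasurable => x Bx.
    by apply: sume_ge0 => c _; exact: hc0.
  rewrite (eq_bigr (fun c => if x \in cubep c then h x else 0%E))//.
  rewrite -big_mkcond/= big_const_seq iter_addr_0.
  have := ds x; case: (count _ _) => [|[|//]] _; first exact: h0.
  by rewrite mulr1n.
move=> c /sB cB; rewrite -integral_mkcondr; congr integral.
by apply/esym/setIidr.
Qed.

Lemma integral_le_sum_cubes (A : set T) (h : T -> \bar R) (s : seq (V * R)) :
  measurable A -> measurable_fun setT h -> (forall x, 0 <= h x)%E ->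
  (forall x, A x -> exists2 c, c \in s & cubep c x) ->
  (\int[leb]_(x in A) h x <= \sum_(c <- s) \int[leb]_(x in cubep c) h x)%E.
Proof.
move=> mA mh h0 As.
have mhc c : measurable_fun setT (h \_ (cubep c)).
  exact: (iffLR (measurable_restrictT h (measurable_cube _ _))
    (measurable_funTS mh)).
have hc0 c x : (0 <= (h \_ (cubep c)) x)%E.
  by rewrite /patch; case: ifPn.
rewrite (eq_bigr (fun c => \int[leb]_x (h \_ (cubep c)) x)%E); last first.
  by move=> c _; rewrite -integral_mkcond.
rewrite -ge0_integral_sum//.
rewrite [leLHS]integral_mkcond.
apply: le_integral_nonmeasurable => x _; rewrite patchE; case: ifPn => //.
  move=> /set_mem /As[c cs cx]; rewrite (big_rem c cs)/= patchE mem_set//.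
  by rewrite leeDl// sume_ge0// => d _; exact: hc0.
by move=> _; apply: sume_ge0 => c _; exact: hc0.
Qed.

End vitali.

(** * A_1 weights *)

Lemma le_centered_cube {R : realType} {n : nat} (k m : nat) : (k <= m)%N ->
  @centered_cube R n k `<=` centered_cube m.
Proof.
move=> km x xk i; have := xk i; rewrite !mxE !mulr2n !addKr.
have : k.+1%:R <= m.+1%:R :> R by rewrite ler_nat ltnS.
move=> ? /andP[? ?]; lra.
Qed.

Lemma cube_sub_centered_cube {R : realType} {n : nat} (a : 'rV[R]_n.+1) (l : R) :
  exists m, cube a l `<=` centered_cube m.
Proof.
have ex (v : Rn R n) : exists m, centered_cube m v.
  have : [set: Rn R n] v by [].
  by rewrite -bigcup_centered_cube => -[m _ vm]; exists m.
have [m1 am1] := ex a; have [m2 am2] := ex (a + const_mx l : 'rV[R]_n.+1).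
exists (maxn m1 m2) => x xa i.
have /andP[h1 _] := le_centered_cube (leq_maxl m1 m2) am1 i.
have /andP[_ h2] := le_centered_cube (leq_maxr m1 m2) am2 i.
have /andP[x1 x2] := xa i; rewrite (le_trans h1 x1)/= (le_trans x2)//.
by apply: le_trans h2; rewrite !mxE.
Qed.

Lemma eventually_expr_lt {R : realType} (q e : R) : 0 <= q < 1 -> 0 < e ->
  \forall k \near \oo, q ^+ k < e.
Proof.
move=> /andP[q0 q1] e0.
have /cvgrPdist_lt /(_ e e0) : GRing.exp q @ \oo --> (0 : R).
  by apply: cvg_expr; rewrite ger0_norm.
apply: filterS => k.
by rewrite sub0r normrN ger0_norm ?exprn_ge0.
Qed.

Lemma exists_nat_floor {R : realType} (m : nat) (x : R) :
  0 <= x <= m.+1%:R -> exists2 k, (k < m.+1)%N & k%:R <= x <= k%:R + 1.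
Proof.
elim: m => [|m ih] /andP[x0 xm]; first by exists 0%N => //; rewrite x0 add0r.
have [le|lt] := leP x m.+1%:R.
  have [|k km kx] := ih; first by rewrite x0.
  by exists k => //; exact: ltnW.
by exists m.+1 => //; rewrite (ltW lt)/= natr1.
Qed.

Section a1_weight.
Context {R : realType} {n : nat}.
Local Notation V := 'rV[R]_n.+1.
Local Notation T := (Rn R n).
Local Notation leb := (@lebn R n).
Local Notation cubep c := (cube c.1 c.2 : set T).

Definition volume (l : R) : R := @unit_volume R n * l ^+ n.+1.

Definition mass (w : T -> R) (c : V * R) : R :=
  fine (weight_measure w (cube c.1 c.2)).

(** The A_1 inequality at [x], with real numbers only. A single null set of points is exceptional
    for all cubes at once. *)
Definition a1_point (C : R) (w : T -> R) (x : T) :=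
  forall c : V * R, 0 < c.2 -> cubep c x -> mass w c <= C * w x * volume c.2.

Lemma locally_integrable_cube (f : T -> R) (a : V) (l : R) :
  locally_integrable_n f -> leb.-integrable (cube a l) (EFin \o f).
Proof.
move=> [mf f_lty]; apply/integrableP; split; last exact/f_lty/compact_cube.
by apply: measurable_funTS; exact/measurable_EFinP.
Qed.

Context (w : T -> R) (w_weight : is_weight w) (C : R) (C_ge1 : 1 <= C)
  (w_a1 : {ae leb, forall x, a1_point C w x}).

Let w_loc : locally_integrable_n w. Proof. by case: w_weight. Qed.
Let w_ge0 x : 0 <= w x. Proof. by case: w_weight. Qed.
Let C_gt0 : 0 < C. Proof. exact: lt_le_trans ltr01 C_ge1. Qed.

Lemma measurable_weight : measurable_fun [set: T] (EFin \o w).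
Proof. exact/measurable_EFinP/w_loc.1. Qed.

Lemma unit_volume_gt0 : 0 < @unit_volume R n.
Proof.
rewrite lt_neqAle unit_volume_ge0 andbT eq_sym; apply/eqP => u0.
by case: w_weight => _ _; apply; exact: lebn_negligible.
Qed.

Lemma volume_gt0 (l : R) : 0 < l -> 0 < volume l.
Proof. by move=> l0; rewrite mulr_gt0 ?unit_volume_gt0 ?exprn_gt0. Qed.

Lemma weight_measure_cube (a : V) (l : R) :
  weight_measure w (cube a l) = (mass w (a, l))%:E.
Proof.
rewrite /mass fineK//; apply: integrable_fin_num; first exact: measurable_cube.
exact: locally_integrable_cube.
Qed.

Lemma mass_ge0 (c : V * R) : 0 <= mass w c.
Proof. by apply: fine_ge0; apply: integral_ge0 => x _; rewrite lee_fin. Qed.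

Lemma measurable_weight_in (D : set T) :
  measurable_fun D (fun x => (w x)%:E).
Proof. by apply: measurable_funTS; exact: measurable_weight. Qed.

Lemma le_mass (c c' : V * R) : cubep c `<=` cubep c' -> mass w c <= mass w c'.
Proof.
case: c c' => [a l] [a' l'] /= cc'.
rewrite -lee_fin -(weight_measure_cube a l) -(weight_measure_cube a' l').
rewrite /weight_measure; apply: (ge0_subset_integral _ (measurable_cube _ _) (measurable_cube _ _)
  (@measurable_weight_in _) _ cc') => x _.
by rewrite lee_fin.
Qed.

(** The A_1 inequality integrated over [E]: the share of the mass lying in [E] is at least the share
    of the volume divided by C. *)
Lemma a1_subset (E : set T) (c : V * R) : 0 < c.2 -> measurable E ->
  E `<=` cubep c ->
  (leb E * (mass w c)%:E <= (C * volume c.2)%:E * weight_measure w E)%E.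
Proof.
move=> c0 mE Ec; have v0 := volume_gt0 c0.
have k0 : (0 <= (C * volume c.2)%:E)%E by rewrite lee_fin ltW// mulr_gt0.
rewrite muleC -integral_cst// /weight_measure.
rewrite -(ge0_integralZl _ mE (@measurable_weight_in _)) //; last first.
  by move=> x _; rewrite lee_fin.
have mm : measurable_fun E (fun x => (C * volume c.2)%:E * (w x)%:E)%E.
  exact: emeasurable_funM (measurable_cst _) (@measurable_weight_in _).
apply: (ae_ge0_le_integral mE _ (measurable_cst _) _ mm).
- by move=> x _; rewrite lee_fin mass_ge0.
- by move=> x _; rewrite mule_ge0// lee_fin.
- apply: filterS w_a1 => x xa Ex; rewrite -EFinM lee_fin /cst.
  by rewrite mulrAC; apply: xa => //; exact: Ec.
Qed.

Lemma a1_doubling (c c' : V * R) : 0 < c'.2 -> 0 < c.2 ->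
  cubep c' `<=` cubep c -> mass w c <= C * (c.2 / c'.2) ^+ n.+1 * mass w c'.
Proof.
move=> c'0 c0 c'c; have := a1_subset c0 (measurable_cube _ _) c'c.
rewrite lebn_cube// weight_measure_cube -!EFinM lee_fin -/(volume c'.2).
rewrite -surjective_pairing => h.
rewrite expr_div_n mulrA mulrAC ler_pdivlMr ?exprn_gt0//.
rewrite -(ler_pM2l unit_volume_gt0).
by move: h; rewrite /volume; congr (_ <= _); ring.
Qed.

Lemma weight_eq0_negligible (c : V * R) : 0 < c.2 -> mass w c = 0 ->
  leb.-negligible (cubep c `&` [set x | w x != 0]).
Proof.
move=> c0 mc0.
have /ae_eq_integral_abs : measurable_fun (cubep c) (fun x => (w x)%:E).
  exact: measurable_weight_in.
move=> /(_ leb (measurable_cube _ _)) [+ _].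
rewrite (@eq_integral _ _ _ _ _ (fun x => (w x)%:E)); last first.
  by move=> x _; rewrite /= ger0_norm.
rewrite -/(weight_measure _ _) weight_measure_cube -surjective_pairing mc0.
move=> /(_ erefl); apply: negligibleS => x [cx wx] /= /(_ cx) [] w0.
by move: wx; rewrite /= w0 eqxx.
Qed.

(** A cube of mass zero would, by doubling, force mass zero on all larger cubes; these exhaust the
    space, so the weight would vanish almost everywhere. *)
Lemma mass_gt0 (c : V * R) : 0 < c.2 -> 0 < mass w c.
Proof.
move=> c0; rewrite lt_neqAle mass_ge0 andbT eq_sym; apply/eqP => mc0.
case: w_weight => _ _; apply.
have [m cm] := cube_sub_centered_cube c.1 c.2.
(* Shifting the index by [m] makes each [d k] contain the cube [c]. *)
pose d k : V * R := (const_mx (- (k + m).+1%:R), (k + m).+1%:R *+ 2).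
have d0 k : 0 < (d k).2 by rewrite pmulrn_lgt0.
have md0 k : mass w (d k) = 0.
  apply/eqP; rewrite eq_le mass_ge0 andbT.
  have := a1_doubling c0 (d0 k); rewrite mc0 mulr0; apply.
  apply: subset_trans cm _.
  by apply: le_centered_cube; exact: leq_addl.
apply: (@negligibleS _ _ _ _ (\bigcup_k (cubep (d k) `&` [set x | w x != 0]))).
  move=> x /= /eqP wx; have : [set: T] x by [].
  rewrite -bigcup_centered_cube => -[k _ Bx]; exists k => //; split => //.
  by apply: le_centered_cube Bx; exact: leq_addr.
by apply: negligible_bigcup => k; exact: weight_eq0_negligible.
Qed.

(** At an A_1 point the unit cube with corner [x] has positive mass, which keeps [w x] away from
    zero. *)
Lemma weight_gt0 : {ae leb, forall x, 0 < w x}.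
Proof.
apply: filterS w_a1 => x xa; have := xa (x : V, 1) ltr01 (cube_nonempty _ ltr01).
move=> /(lt_le_trans (@mass_gt0 (x : V, 1) ltr01)) /=.
by rewrite pmulr_lgt0 ?volume_gt0// pmulr_rgt0.
Qed.

(** The complement of a half-size cube holds at least half of the volume, hence at least the
    fraction 1 / (2 C) of the mass; this is the fraction that may remain. *)
Definition a1_ratio : R := 1 - (2 * C)^-1.

Lemma a1_ratio_gt0 : 0 < a1_ratio.
Proof.
have C2 : 1 < 2 * C by have := C_ge1; lra.
by rewrite subr_gt0 invf_lt1// (lt_trans ltr01).
Qed.

Lemma a1_ratio_lt1 : a1_ratio < 1.
Proof. by rewrite ltrBlDr ltrDl invr_gt0 mulr_gt0. Qed.

Lemma a1_reverse_doubling (c c' : V * R) : 0 < c'.2 -> c'.2 <= c.2 / 2 ->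
  cubep c' `<=` cubep c -> mass w c' <= a1_ratio * mass w c.
Proof.
move=> c'0 cc2 c'c; have c0 : 0 < c.2 by lra.
have mQ := measurable_cube c.1 c.2; have mQ' := measurable_cube c'.1 c'.2.
have mE : measurable (cubep c `\` cubep c') by exact: measurableD.
have := a1_subset c0 mE (@subDsetl _ _ _).
have -> : leb (cubep c `\` cubep c') = (volume c.2 - volume c'.2)%:E.
  have Q_lty : (leb (cubep c) < +oo)%E by rewrite lebn_cube ?ltry.
  transitivity (leb (cubep c) - leb (cubep c'))%E.
    by rewrite (measureD mQ mQ' Q_lty); congr (_ - leb _)%E; exact/setIidr.
  by rewrite !lebn_cube.
have -> : weight_measure w (cubep c `\` cubep c') =
          (mass w c - mass w c')%:E.
  have := @ge0_integral_setU _ _ _ leb _ _ mQ' mE (fun x => (w x)%:E)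
    (@measurable_weight_in _) (fun x _ => w_ge0 x).
  rewrite setDUK// => /(_ _)/wrap[].
    by apply/disj_setPS => x [? []].
  rewrite -!/(weight_measure _ _) !weight_measure_cube -!surjective_pairing.
  by case: (weight_measure w _) => [r| |]//= [->]; congr EFin; ring.
rewrite -!EFinM lee_fin => h.
(* Halving the side divides the volume by 2^(n+1), which is at least 2. *)
have v2 : volume c'.2 <= volume c.2 / 2.
  rewrite /volume -mulrA ler_pM2l ?unit_volume_gt0//.
  apply: (@le_trans _ _ ((c.2 / 2) ^+ n.+1)).
    by apply: lerXn2r => //; rewrite nnegrE; lra.
  rewrite expr_div_n ler_pM2l ?exprn_gt0// lef_pV2 ?posrE ?exprn_gt0//.
  by rewrite exprS -[leLHS]mulr1 ler_pM2l// exprn_ege1//; lra.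
have v0 := volume_gt0 c0.
have : volume c.2 / 2 * mass w c <= C * volume c.2 * (mass w c - mass w c').
  by apply: le_trans h; rewrite ler_wpM2r ?mass_ge0//; lra.
have -> : volume c.2 / 2 * mass w c = volume c.2 * (mass w c / 2) by ring.
have -> : C * volume c.2 * (mass w c - mass w c') =
  volume c.2 * (C * (mass w c - mass w c')) by ring.
rewrite ler_pM2l// -[leLHS]subr0 -subr_ge0 => hm.
rewrite -subr_ge0 -(pmulr_rge0 _ C_gt0); apply: le_trans hm _.
by rewrite /a1_ratio le_eqVlt; apply/orP; left; apply/eqP; field;
  rewrite gt_eqF.
Qed.

End a1_weight.

Section cube_geometry.
Context {R : realType} {n : nat}.
Local Notation V := 'rV[R]_n.+1.
Local Notation T := (Rn R n).
Local Notation cubep c := (cube c.1 c.2 : set T).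

Lemma sub_cubeP (c c' : V * R) : 0 < c'.2 -> cubep c' `<=` cubep c ->
  forall i, c.1 ord0 i <= c'.1 ord0 i /\
            c'.1 ord0 i + c'.2 <= c.1 ord0 i + c.2.
Proof.
move=> c'0 c'c i; split.
  by have /andP[] := c'c _ (cube_nonempty c'.1 c'0) i.
have : cubep c' (c'.1 + const_mx c'.2 : V).
  by move=> j; rewrite !mxE lexx lerDl ltW.
by move=> /c'c /(_ i) /andP[]; rewrite !mxE.
Qed.

Lemma intermediate_cube (c c' : V * R) (l : R) : 0 < c'.2 ->
  c'.2 <= l <= c.2 -> cubep c' `<=` cubep c ->
  exists a : V, cubep c' `<=` cube a l /\ (cube a l : set T) `<=` cubep c.
Proof.
move=> c'0 /andP[l1 l2] /(sub_cubeP c'0) cc'.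
(* The corner of [c'] is lowered just enough for a side [l] to end inside [c]. *)
exists (\row_i Num.min (c'.1 ord0 i) (c.1 ord0 i + c.2 - l)).
split=> x xc i; have := xc i; have [] := cc' i; rewrite !mxE /=;
  case: (leP (c'.1 ord0 i) (c.1 ord0 i + c.2 - l)) => ? ? ? /andP[? ?]; lra.
Qed.

End cube_geometry.

Section a1_covering.
Context {R : realType} {n : nat}.
Local Notation V := 'rV[R]_n.+1.
Local Notation T := (Rn R n).
Local Notation leb := (@lebn R n).
Local Notation cubep c := (cube c.1 c.2 : set T).

Context (w : T -> R) (w_weight : is_weight w) (C : R) (C_ge1 : 1 <= C)
  (w_a1 : {ae leb, forall x, a1_point C w x}).

Let w_ge0 x : 0 <= w x. Proof. by case: w_weight. Qed.

(** Climbing from [c'] towards [c] through nested cubes of doubled side, each step gains one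
    reverse-doubling factor. *)
Lemma mass_decay (k : nat) (c c' : V * R) : 0 < c'.2 -> c'.2 * 2 ^+ k <= c.2 ->
  cubep c' `<=` cubep c -> mass w c' <= a1_ratio C ^+ k * mass w c.
Proof.
elim: k c' => [|k ih] c' c'0 c'k c'c; first by rewrite mul1r le_mass.
have kl : 2 <= 2 ^+ k.+1 :> R by rewrite exprS ler_peMr// exprn_ege1//; lra.
have c'2 : c'.2 <= c'.2 * 2 <= c.2.
  rewrite ler_peMr ?(ltW c'0)//=; last lra.
  by apply: le_trans c'k; rewrite ler_wpM2l// ltW.
have [a [c'a ac]] := intermediate_cube c'0 c'2 c'c.
have a0 : 0 < (a, c'.2 * 2).2 by rewrite mulr_gt0.
have := ih (a, c'.2 * 2) a0; rewrite /= -mulrA -exprS => /(_ c'k ac) ma.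
rewrite exprS -mulrA; apply: le_trans (_ : a1_ratio C * mass w (a, c'.2 * 2) <= _).
  by apply: (a1_reverse_doubling w_weight C_ge1 w_a1) => //=; lra.
by rewrite ler_pM2l// a1_ratio_gt0.
Qed.

Lemma grid_cover (a : V) (l : R) (m : nat) : 0 < l ->
  exists s : seq (V * R), [/\ forall c, c \in s -> c.2 = l / m.+1%:R,
    forall c, c \in s -> cubep c `<=` cube a l &
    forall x : T, cube a l x -> exists2 c, c \in s & cubep c x].
Proof.
move=> l0; set h := l / m.+1%:R; have h0 : 0 < h by rewrite divr_gt0.
have hm : l = h * m.+1%:R by rewrite divfK// pnatr_eq0.
pose g (f : {ffun 'I_n.+1 -> 'I_m.+1}) : V * R :=
  (\row_i (a ord0 i + h * (f i)%:R), h).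
exists [seq g f | f : {ffun 'I_n.+1 -> 'I_m.+1}]; split.
- by move=> c /mapP[f _ ->].
- move=> c /mapP[f _ ->] x xg i; have := xg i; rewrite /= mxE.
  have f0 : 0 <= h * (f i)%:R by rewrite mulr_ge0 ?(ltW h0).
  have fm : h * (f i)%:R + h <= l.
    by rewrite hm -{2}(mulr1 h) -mulrDr ler_pM2l// natr1 ler_nat.
  by move=> /andP[? ?]; lra.
- move=> x xQ.
  have ex i : exists k : 'I_m.+1, h * k%:R <= x ord0 i - a ord0 i <= h * k%:R + h.
    have [|k km /andP[k1 k2]] := @exists_nat_floor _ m ((x ord0 i - a ord0 i) / h).
      have := xQ i; rewrite ler_pdivrMr// divr_ge0 ?(ltW h0)//=.
        by rewrite mulrC -hm => /andP[_ ?]; lra.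
      by have /andP[? _] := xQ i; lra.
    exists (Ordinal km) => /=; move: k1 k2; rewrite ler_pdivlMr// ler_pdivrMr//.
    by rewrite mulrDl mul1r mulrC => -> ->.
  pose f := [ffun i => xchoose (ex i)].
  exists (g f); first by apply/mapP; exists f; rewrite // mem_enum.
  move=> i; rewrite /= mxE ffunE; have /andP[? ?] := xchooseP (ex i); lra.
Qed.

Lemma mass_tripled (c : V * R) : 0 < c.2 ->
  mass w (tripled c) <= C * 3 ^+ n.+1 * mass w c.
Proof.
move=> c0; have d0 : 0 < (tripled c).2 by rewrite pmulrn_lgt0.
have := a1_doubling w_weight C_ge1 w_a1 c0 d0 (sub_tripled (lexx _) _).
have -> : (tripled c).2 / c.2 = 3.
  by rewrite /= -mulr_natr; field; rewrite gt_eqF.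
by apply; exists c.1; split; exact: cube_nonempty.
Qed.

(** The cells of a fine grid are thinned to a disjoint subfamily, since closed cells share faces,
    and then tripled. The masses still add up to at most C 3^(n+1) mu(Q), while the extra factor
    mu(d)^al is at most a constant times r^(al k) with r < 1, so the total tends to zero with k. *)
Lemma mass_powR_cover (c : V * R) (al delta eta : R) : 0 < c.2 ->
  0 < al -> 0 < delta -> 0 < eta ->
  exists s : seq (V * R), [/\ forall d, d \in s -> 0 < d.2 < delta,
    forall x : T, cubep c x -> exists2 d, d \in s & cubep d x &
    \sum_(d <- s) mass w d * mass w d `^ al < eta].
Proof.
move=> c0 al0 delta0 eta0.
have r0 := a1_ratio_gt0 C_ge1; have r1 := a1_ratio_lt1 C_ge1.
set r := a1_ratio C in r0 r1.
have ral : 0 <= r `^ al < 1.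
  have <- : 1 `^ al = 1 :> R by rewrite powR1.
  rewrite powR_ge0/=; apply: gt0_ltr_powR => //.
    by rewrite nnegrE ltW.
  by rewrite nnegrE.
have half : 0 <= (2^-1 : R) < 1 by rewrite invr_ge0 ler0n/= invf_lt1// ltr1n.
pose M := mass w (tripled c) `^ al.
pose K := C * 3 ^+ n.+1 * mass w c.
have m0 c' : 0 <= mass w c' by exact: mass_ge0.
have K0 : 0 <= K by rewrite !mulr_ge0 ?m0// (le_trans ler01).
have M0 : 0 <= M by exact: powR_ge0.
(* This bounds r^(al k) so that the final total stays below [eta], and [e2] bounds 2^-k so that
   tripled cells have side below [delta]. The + 1 keeps the denominator positive. *)
have e1 : 0 < eta / (M * K + 1) by rewrite divr_gt0// ltr_wpDl// mulr_ge0.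
have e2 : 0 < delta / (c.2 * 3) by rewrite divr_gt0// mulr_gt0.
have [k [k1 k2]] := filter_ex (filterI (eventually_expr_lt ral e1)
                                       (eventually_expr_lt half e2)).
(* [grid_cover] divides the side by the successor of its argument, hence the predecessor of 2^k. *)
have [s0 [s0h s0c cs0]] := grid_cover c.1 (2 ^ k).-1 c0.
have {}s0h d : d \in s0 -> d.2 = c.2 / 2 ^+ k.
  by move=> /s0h ->; rewrite prednK ?expn_gt0// natrX.
have h0 : 0 < c.2 / 2 ^+ k by rewrite divr_gt0// exprn_gt0.
have [|s [ss0 ds s0s]] := @vitali_cubes _ _ s0.
  by move=> d /s0h ->.
exists [seq tripled d | d <- s]; split.
- move=> _ /mapP[d /ss0/s0h dh ->]; rewrite /= dh pmulrn_lgt0//=.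
  move: k2; rewrite exprVn ltr_pdivlMr ?mulr_gt0//.
  by congr (_ < _); rewrite -mulr_natr; ring.
- move=> x /cs0[d /s0s[d' d's dd'] dx]; exists (tripled d'); last exact: dd'.
  exact: map_f.
rewrite big_map.
have sum_mass : \sum_(d <- s) mass w d <= mass w c.
  have wf : measurable_fun (cubep c) (fun x => (w x)%:E).
    exact: (@measurable_weight_in _ _ _ w_weight).
  have := sum_integral_cubes (measurable_cube _ _) wf (fun x _ => w_ge0 x) _ ds.
  rewrite (eq_bigr (fun d => (mass w d)%:E)); last first.
    by move=> d _; rewrite -/(weight_measure w _) weight_measure_cube//.
  rewrite sumEFin -/(weight_measure w _) weight_measure_cube// lee_fin.
  by apply => d /ss0/s0c.
apply: (@le_lt_trans _ _ (\sum_(d <- s)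
    (r `^ al) ^+ k * M * (C * 3 ^+ n.+1) * mass w d)).
  rewrite big_seq [leRHS]big_seq; apply: ler_sum => d ds'.
  have dh := s0h _ (ss0 _ ds'); have dc := s0c _ (ss0 _ ds').
  have d0 : 0 < d.2 by rewrite dh.
  have d30 : 0 < (tripled d).2 by rewrite pmulrn_lgt0.
  have le1 := mass_tripled d0.
  have le2 : mass w (tripled d) `^ al <= (r `^ al) ^+ k * M.
    have td : cubep (tripled d) `<=` cubep (tripled c).
      move=> x xd i; have [? ?] := sub_cubeP d0 dc i.
      have := xd i; rewrite /= !mxE => /andP[? ?].
      have : d.2 <= c.2.
        rewrite dh ler_pdivrMr ?exprn_gt0// ler_peMr ?(ltW c0)//.
        by rewrite exprn_ege1// ler1n.
      move=> ?; lra.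
    have tk : (tripled d).2 * 2 ^+ k <= (tripled c).2.
      by rewrite /= mulrnAl dh divfK// expf_neq0// pnatr_eq0.
    have := mass_decay d30 tk td; rewrite -/r => md.
    have -> : (r `^ al) ^+ k = (r ^+ k) `^ al.
      rewrite -powR_mulrn; last exact: powR_ge0.
      rewrite -[in RHS]powR_mulrn; last exact: ltW.
      exact: powRAC.
    rewrite -powRM ?exprn_ge0 ?(ltW r0)//.
    apply: ge0_ler_powR md; rewrite ?(ltW al0)// nnegrE ?m0//.
    by rewrite mulr_ge0// exprn_ge0// ltW.
  have := ler_pM (m0 _) (powR_ge0 _ _) le1 le2.
  by move=> /le_trans; apply; rewrite [leLHS]mulrC -!mulrA.
rewrite -mulr_sumr; apply: (@le_lt_trans _ _ ((r `^ al) ^+ k * (M * K))).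
  rewrite [leRHS](_ : _ = (r `^ al) ^+ k * M * (C * 3 ^+ n.+1) * mass w c).
    apply: ler_wpM2l => //; rewrite !mulr_ge0 ?exprn_ge0 ?powR_ge0//.
    exact: le_trans ler01 C_ge1.
  by rewrite /K; ring.
have MK : 0 < M * K + 1 by rewrite ltr_wpDl// mulr_ge0.
move: k1; rewrite ltr_pdivlMr//; apply: le_lt_trans.
by rewrite ler_wpM2l ?exprn_ge0 ?powR_ge0// lerDl.
Qed.

End a1_covering.

(** * The maximal function of a weight *)

Section rational_cubes.
Context {R : realType} {n : nat}.
Local Notation V := 'rV[R]_n.+1.
Local Notation T := (Rn R n).
Local Notation cubep c := (cube c.1 c.2 : set T).

(** An enumeration of the cubes with rational corner and positive rational side. All other indices
    give a default unit cube, so that every value is a genuine cube. *)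
Definition rational_cube (k : nat) : V * R :=
  if @unpickle ('rV[rat]_n.+1 * rat)%type k is Some q then
    if 0 < q.2 then (map_mx ratr q.1, ratr q.2) else (0, 1)
  else (0, 1).

Lemma rational_cube_gt0 (k : nat) : 0 < (rational_cube k).2.
Proof.
rewrite /rational_cube; case: unpickle => [q|//].
by case: ifPn => //=; rewrite ltr0q.
Qed.

Lemma exists_rational_cube (c : V * R) : 0 < c.2 ->
  exists k, cubep c `<=` cubep (rational_cube k) /\
            cubep (rational_cube k) `<=` cubep (tripled c).
Proof.
move=> c0.
have ex_rat (x y : R) : x < y -> exists q : rat, x < ratr q < y.
  by move=> /rat_in_itvoo[q]; rewrite in_itv/= => ?; exists q.
(* With side between 3/2 and 2 times that of [c] and corner lower by less than half a side, the cube
   covers [c] and stays in its triple. *)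
have [r /andP[r1 r2]] : exists q : rat, c.2 * 3 / 2 < ratr q < c.2 * 2.
  by apply: ex_rat; lra.
have exa i : exists q : rat, c.1 ord0 i - c.2 / 2 < ratr q < c.1 ord0 i.
  by apply: ex_rat; lra.
pose a : 'rV[rat]_n.+1 := \row_i xchoose (exa i).
have r0 : 0 < r by rewrite -(@ltr0q R); lra.
have [k kE] : exists k, rational_cube k = (map_mx ratr a, ratr r).
  by exists (pickle (a, r)); rewrite /rational_cube pickleK/= r0.
exists k; rewrite kE; split=> x xc i; have := xc i; rewrite /= !mxE;
  have /andP[a1 a2] := xchooseP (exa i) => /andP[? ?]; lra.
Qed.

End rational_cubes.

(** * Weak-type estimate for the weighted maximal function *)

Section weak_type.
Context {R : realType} {n : nat}.
Local Notation V := 'rV[R]_n.+1.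
Local Notation T := (Rn R n).
Local Notation leb := (@lebn R n).
Local Notation cubep c := (cube c.1 c.2 : set T).
Local Notation rcube := (@rational_cube R n).

Definition weighted_integral (w f : T -> R) (A : set T) : \bar R :=
  (\int[leb]_(x in A) (`|f x| * w x)%:E)%E.

Definition heavy (w f : T -> R) (t : R) (c : V * R) : bool :=
  ((t * mass w c)%:E < weighted_integral w f (cubep c))%E.

(** A measurable stand-in for a level set of the weighted maximal function: only countably many
    cubes enter. *)
Definition heavy_set (w f : T -> R) (t : R) : set T :=
  \bigcup_(k in [set k | heavy w f t (rcube k)])
    cubep (rcube k).

Lemma measurable_heavy_set (w f : T -> R) (t : R) :
  measurable (heavy_set w f t).
Proof. by apply: bigcup_measurable => k _; exact: measurable_cube. Qed.

Context (w : T -> R) (w_weight : is_weight w) (C : R) (C_ge1 : 1 <= C)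
  (w_a1 : {ae leb, forall x, a1_point C w x}).

Let w_ge0 x : 0 <= w x. Proof. by case: w_weight. Qed.

Lemma measurable_weighted_fun (f : T -> R) : measurable_fun setT f ->
  measurable_fun [set: T] (fun x => (`|f x| * w x)%:E).
Proof.
move=> mf; apply/measurable_EFinP; apply: measurable_funM.
  exact: measurableT_comp mf.
exact/measurable_EFinP/(@measurable_weight _ _ _ w_weight).
Qed.

Lemma weighted_fun_ge0 (f : T -> R) (x : T) : (0 <= (`|f x| * w x)%:E)%E.
Proof. by rewrite lee_fin mulr_ge0. Qed.

(** Vitali's argument: the triples of a disjoint subfamily cover [A], tripling costs a factor C
    3^(n+1) in mass, and heaviness exchanges mass for the integral of |f| w over disjoint cubes. *)
Lemma weak_type_finite (f : T -> R) (t : R) (s : seq (V * R)) (A : set T) :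
  measurable_fun setT f -> 0 < t -> measurable A ->
  (forall c, c \in s -> 0 < c.2 /\ heavy w f t c) ->
  (forall x, A x -> exists2 c, c \in s & cubep c x) ->
  (weight_measure w A <=
    (C * 3 ^+ n.+1 / t)%:E * weighted_integral w f setT)%E.
Proof.
move=> mf t0 mA sh As.
have [|s' [s's ds' ss']] := @vitali_cubes _ _ s; first by move=> c /sh[].
have mw := @measurable_weight _ _ _ w_weight.
apply: (@le_trans _ _ (\sum_(c <- map tripled s') (mass w c)%:E)%E).
  under eq_bigr do rewrite -(weight_measure_cube w_weight).
  apply: (integral_le_sum_cubes mA mw _ _) => [x|x /As[c cs cx]].
    by rewrite lee_fin.
  have [c' c's' cc'] := ss' _ cs.
  by exists (tripled c'); [exact: map_f|exact: cc'].
rewrite big_map.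
apply: (@le_trans _ _ (\sum_(c <- s') (C * 3 ^+ n.+1 / t)%:E *
   weighted_integral w f (cubep c))%E).
  rewrite big_seq [leRHS]big_seq; apply: lee_sum => c /s's/sh[c0 hc].
  apply: (@le_trans _ _ ((C * 3 ^+ n.+1 / t)%:E * (t * mass w c)%:E)%E).
    rewrite -EFinM lee_fin mulrA divfK ?gt_eqF//.
    exact: (mass_tripled w_weight C_ge1 w_a1).
  apply: lee_wpmul2l; last exact: ltW.
  by rewrite lee_fin divr_ge0 ?(ltW t0)// mulr_ge0// (le_trans ler01).
rewrite -ge0_sume_distrr; last first.
  by move=> c _; apply: integral_ge0 => x _; exact: weighted_fun_ge0.
apply: lee_wpmul2l.
  by rewrite lee_fin divr_ge0 ?(ltW t0)// mulr_ge0// (le_trans ler01).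
apply: (sum_integral_cubes measurableT (measurable_weighted_fun mf)) => // x _.
exact: weighted_fun_ge0.
Qed.

(** The covering lemma is for finite families; the sets [F m], built from the first [m] rational
    cubes, increase to the heavy set and the bound passes to the limit. *)
Lemma weak_type (f : T -> R) (t : R) : measurable_fun setT f -> 0 < t ->
  (weight_measure w (heavy_set w f t) <=
    (C * 3 ^+ n.+1 / t)%:E * weighted_integral w f setT)%E.
Proof.
move=> mf t0.
pose F m : set T := \bigcup_(k in [set k | (k < m)%N /\
  heavy w f t (rcube k)])
    cubep (rcube k).
have mF m : measurable (F m).
  by apply: bigcup_measurable => k _; exact: measurable_cube.
have -> : heavy_set w f t = \bigcup_m F m.
  apply/seteqP; split=> [x [k hk kx]|x [m _ [k [_ hk] kx]]]; last by exists k.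
  by exists k.+1 => //; exists k => //; split => //=.
have ndF : nondecreasing_seq F.
  move=> m m' mm'; apply/subsetPset => x [k [km hk] kx]; exists k => //.
  by split => //; exact: leq_trans mm'.
have cv := ge0_nondecreasing_set_cvg_integral (mu := leb) ndF mF
  (fun _ => @measurable_weight_in _ _ _ w_weight _) (fun _ x _ => w_ge0 x).
rewrite /weight_measure -(cvg_lim _ cv)//; apply: lime_le; first exact: cvgP cv.
apply: nearW => m.
apply: (@weak_type_finite f t
  [seq rcube k | k <- iota 0 m & heavy w f t (rcube k)]) => //.
  move=> _ /mapP[k + ->]; rewrite mem_filter => /andP[hk _].
  by split => //; exact: rational_cube_gt0.
move=> x [k [km hk] kx]; exists (rcube k) => //.
by apply: map_f; rewrite mem_filter hk mem_iota.
Qed.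

(* Truncating [f] at height [t / 2] costs at most [t / 2] in every average. *)
Lemma weak_type_truncated (f : T -> R) (t : R) :
  measurable_fun setT f -> 0 < t ->
  (weight_measure w (heavy_set w f t) <= (C * 3 ^+ n.+1 * 2 / t)%:E *
    weighted_integral w f [set x | t / 2 < `|f x|]%R)%E.
Proof.
move=> mf t0.
have mnf : measurable_fun setT (fun x => `|f x|) by exact: measurableT_comp mf.
pose A : set T := [set x | t / 2 < `|f x|].
have mA : measurable A.
  have := mnf measurableT _ (measurable_itv `]t / 2, +oo[).
  rewrite setTI (_ : _ @^-1` _ = A)//.
  by apply/seteqP; split=> x; rewrite /A/= in_itv/= andbT.
pose f1 x := f x * \1_A x.
have mf1 : measurable_fun setT f1.
  exact: measurable_funM mf (measurable_indic mA).
have sub : heavy_set w f t `<=` heavy_set w f1 (t / 2).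
  move=> x [k hk kx]; exists k => //=; rewrite /= /heavy in hk *.
  rewrite ltNge; apply: contraTN hk => hk; rewrite -leNgt.
  have mQ := measurable_cube (rcube k).1 (rcube k).2.
  have m1 := measurable_funTS (D := cubep (rcube k)) (measurable_weighted_fun mf1).
  have mw := @measurable_weight_in _ _ _ w_weight (cubep (rcube k)).
  have t20 : (0 <= (t / 2)%:E)%E by rewrite lee_fin divr_ge0// ltW.
  have m2 : measurable_fun (cubep (rcube k)) (fun x => (t / 2)%:E * (w x)%:E)%E.
    exact: emeasurable_funM (measurable_cst _) mw.
  apply: (@le_trans _ _ (\int[leb]_(x in cubep (rcube k))
      ((`|f1 x| * w x)%:E + (t / 2)%:E * (w x)%:E))%E).
    apply: le_integral_nonmeasurable => y _; first exact: weighted_fun_ge0.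
    rewrite -EFinM -EFinD lee_fin -mulrDl ler_wpM2r// /f1 indicE.
    have [yA|] := boolP (y \in A); first by rewrite mulr1 lerDl divr_ge0// ltW.
    rewrite mulr0 normr0 add0r; move=> /negP yA; rewrite leNgt; apply/negP => ?.
    by apply: yA; rewrite inE.
  rewrite (ge0_integralD _ mQ _ m1 _ m2); last 2 first.
  - by move=> y _; exact: weighted_fun_ge0.
  - by move=> y _; rewrite mule_ge0// lee_fin.
  rewrite (ge0_integralZl _ mQ mw) //; last by move=> y _; rewrite lee_fin.
  rewrite -/(weight_measure w _) weight_measure_cube// -EFinM.
  have -> : (t * mass w (rcube k))%:E =
    ((t / 2 * mass w (rcube k))%:E + (t / 2 * mass w (rcube k))%:E)%E.
    by rewrite -EFinD; congr EFin; field.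
  exact: leeD.
apply: le_trans (_ : weight_measure w (heavy_set w f1 (t / 2)) <= _)%E.
  apply: (ge0_subset_integral _ (measurable_heavy_set _ _ _)
    (measurable_heavy_set _ _ _) (@measurable_weight_in _ _ _ w_weight _) _ sub).
  by move=> x _; rewrite lee_fin.
apply: le_trans (weak_type mf1 _) _; first by rewrite divr_gt0.
rewrite le_eqVlt; apply/orP; left; apply/eqP; congr (_%:E * _)%E.
  by field; rewrite gt_eqF.
rewrite /weighted_integral [RHS]integral_mkcond; apply: eq_integral => x _.
rewrite patchE /f1 indicE; case: (x \in A) => /=.
  by rewrite mulr1.
by rewrite mulr0 normr0 mul0r.
Qed.

End weak_type.

(** * Geometric sums over dyadic levels *)

Section geometric_levels.
Context {R : realType}.

(** A geometric sum is comparable with its last term, and the last level counted is below y. The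
    bound is uniform in [e] and [m], so it serves both the ascending levels 2^k and, read backwards
    from e = 2^-m, the descending ones. *)
Lemma geometric_levels (s e y : R) (m : nat) : 0 < s -> 0 < e -> 0 <= y ->
  \sum_(0 <= k < m) ((e * 2 ^+ k) `^ s * (e * 2 ^+ k < y)%R%:R)
    <= 2 `^ s / (2 `^ s - 1) * y `^ s.
Proof.
move=> s0 e0 y0; set r := 2 `^ s.
have r1 : 1 < r.
  have <- : 1 `^ s = 1 :> R by rewrite powR1.
  by apply: gt0_ltr_powR; rewrite ?nnegrE//; lra.
have r10 : 0 < r - 1 by rewrite subr_gt0.
have aS k : (e * 2 ^+ k.+1) `^ s = r * (e * 2 ^+ k) `^ s.
  have ek : 0 <= e * 2 ^+ k by rewrite mulr_ge0 ?exprn_ge0// ltW.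
  by rewrite exprS mulrCA [LHS]powRM.
have full j : \sum_(0 <= k < j) ((e * 2 ^+ k) `^ s * (e * 2 ^+ k < y)%R%:R)
    <= (e * 2 ^+ j) `^ s / (r - 1).
  elim: j => [|j ih].
    by rewrite big_nil divr_ge0 ?powR_ge0// ltW.
  rewrite big_nat_recr//= aS.
  have a0 : 0 <= (e * 2 ^+ j) `^ s by exact: powR_ge0.
  have -> : r * (e * 2 ^+ j) `^ s / (r - 1) =
    (e * 2 ^+ j) `^ s / (r - 1) + (e * 2 ^+ j) `^ s.
    by field; rewrite gt_eqF.
  apply: lerD => //.
  by case: (_ < _); rewrite ?mulr1 ?mulr0.
elim: m => [|m ih].
  by rewrite big_nil mulr_ge0 ?powR_ge0// divr_ge0 ?powR_ge0// ltW.
rewrite big_nat_recr//=; have [lt|_] := ltP (e * 2 ^+ m) y; last first.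
  by rewrite mulr0 addr0.
rewrite mulr1; apply: le_trans (_ : r / (r - 1) * (e * 2 ^+ m) `^ s <= _).
  have -> : r / (r - 1) * (e * 2 ^+ m) `^ s =
    (e * 2 ^+ m) `^ s / (r - 1) + (e * 2 ^+ m) `^ s.
    by field; rewrite gt_eqF.
  by rewrite lerD2r full.
apply: ler_wpM2l; first by rewrite divr_ge0 ?powR_ge0// ltW.
by apply: ge0_ler_powR; rewrite ?nnegrE ?(ltW s0)// ?(ltW lt)// mulr_ge0 ?exprn_ge0// ltW.
Qed.

Lemma geometric_levels_up (s y : R) (m : nat) : 0 < s -> 0 <= y ->
  \sum_(0 <= k < m) ((2 ^+ k) `^ s * (2 ^+ k < y)%R%:R)
    <= 2 `^ s / (2 `^ s - 1) * y `^ s.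
Proof.
move=> s0 y0; have := geometric_levels m s0 ltr01 y0.
by under eq_bigr do rewrite mul1r.
Qed.

Lemma geometric_levels_down (s y : R) (m : nat) : 0 < s -> 0 <= y ->
  \sum_(0 <= k < m) ((2 ^- k.+1) `^ s * (2 ^- k.+1 < y)%R%:R)
    <= 2 `^ s / (2 `^ s - 1) * y `^ s.
Proof.
move=> s0 y0; have e0 : 0 < 2 ^- m :> R by rewrite invr_gt0 exprn_gt0.
have := geometric_levels m s0 e0 y0; rewrite big_nat_rev/= add0n.
rewrite big_nat [in X in _ -> X]big_nat.
rewrite (eq_bigr (fun k => (2 ^- k.+1) `^ s * (2 ^- k.+1 < y)%R%:R))//.
move=> k /= km; have -> : 2 ^- m * 2 ^+ (m - k.+1) = 2 ^- k.+1 :> R; last by [].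
by rewrite expfB_cond// ?mulKf ?expf_neq0// pnatr_eq0.
Qed.

Lemma exists_level_up (v : R) : 1 < v -> exists k, 2 ^+ k < v <= 2 ^+ k.+1.
Proof.
move=> v1.
have ex : exists k, v <= 2 ^+ k.
  exists (Num.bound v); rewrite ltW//; apply: lt_le_trans (archi_boundP _) _.
    by rewrite (le_trans ler01)// ltW.
  by rewrite -natrX ler_nat ltnW// ltn_expl.
case: (ex_minnP ex) => -[|k] vk kmin; first by rewrite expr0 leNgt v1 in vk.
exists k; rewrite vk andbT ltNge; apply/negP => /kmin; by rewrite ltnn.
Qed.

Lemma exists_level_down (v : R) : 0 < v <= 1 ->
  exists k, 2 ^- k.+1 < v <= 2 * 2 ^- k.+1.
Proof.
move=> /andP[v0 v1].
have ex : exists k, 2 ^- k.+1 < v.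
  exists (Num.bound v^-1); rewrite invf_plt ?posrE ?exprn_gt0//.
  apply: lt_le_trans (archi_boundP _) _; first by rewrite invr_ge0 ltW.
  by rewrite -natrX ler_nat ltnW// (ltn_trans (ltnSn _))// ltn_expl.
case: (ex_minnP ex) => k vk kmin; exists k; rewrite vk/=.
case: k vk kmin => [|k] vk kmin; first by rewrite expr1 divff ?pnatr_eq0.
rewrite exprS invfM mulVKf ?pnatr_eq0// leNgt; apply/negP => /kmin.
by rewrite ltnn.
Qed.

End geometric_levels.

(** * Strong-type estimate for the weighted maximal function *)

Section strong_type.
Context {R : realType} {n : nat}.
Local Notation V := 'rV[R]_n.+1.
Local Notation T := (Rn R n).
Local Notation leb := (@lebn R n).
Local Notation cubep c := (cube c.1 c.2 : set T).
Local Notation rcube := (@rational_cube R n).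

Definition weighted_maximal (w f : T -> R) (x : T) : \bar R :=
  ereal_sup [set (weighted_integral w f (cubep c) * ((mass w c)^-1)%:E)%E |
             c in [set c : V * R | 0 < c.2 /\ cubep c x]].

Context (w : T -> R) (w_weight : is_weight w) (C : R) (C_ge1 : 1 <= C)
  (w_a1 : {ae leb, forall x, a1_point C w x}).

Let w_ge0 x : 0 <= w x. Proof. by case: w_weight. Qed.

Definition a1_dilation : R := C * 3 ^+ n.+1.

Let A := a1_dilation.

Lemma a1_dilation_gt0 : 0 < A.
Proof. by rewrite mulr_gt0 ?exprn_gt0// (lt_le_trans ltr01). Qed.

Lemma weighted_integral_ge0 (f : T -> R) (B : set T) :
  (0 <= weighted_integral w f B)%E.
Proof. by apply: integral_ge0 => x _; exact: weighted_fun_ge0. Qed.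

(** A cube with weighted average above [t] sits in a rational cube inside its triple. The mass grows
    by at most the factor [A], so the rational cube still has average above t / A. *)
Lemma lt_weighted_maximal (f : T -> R) (t : R) (x : T) :
  measurable_fun setT f -> 0 < t -> (t%:E < weighted_maximal w f x)%E ->
  heavy_set w f (t / A) x.
Proof.
move=> mf t0 /ereal_sup_gt[_ [c [c0 cx] <-]].
have mc0 := mass_gt0 w_weight C_ge1 w_a1 c0.
rewrite lte_pdivlMr// -EFinM => hc.
have [k [ck kc]] := exists_rational_cube c0; exists k; last exact: ck.
rewrite /= /heavy; apply: (@le_lt_trans _ _ (t * mass w c)%:E); last first.
  apply: lt_le_trans hc _.
  by apply: (ge0_subset_integral _ (measurable_cube _ _) (measurable_cube _ _)
    (measurable_funTS (measurable_weighted_fun w_weight mf)) _ ck) => y _;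
    exact: weighted_fun_ge0.
rewrite lee_fin mulrAC -mulrA ler_pM2l// ler_pdivrMr ?a1_dilation_gt0//.
rewrite mulrC; apply: le_trans (mass_tripled w_weight C_ge1 w_a1 c0).
exact: le_mass.
Qed.

(** A discrete layer-cake majorant of (M_mu f)^p w. The factor 2 is the ratio of consecutive levels:
    if t k < M_mu f (x) <= 2 t k, then term k alone is at least (M_mu f (x))^p w(x). *)
Definition level_sum (f : T -> R) (p : R) (t : nat -> R) (x : T) : \bar R :=
  (\sum_(0 <= k <oo)
    ((2 * t k) `^ p)%:E * ((w x)%:E * (\1_(heavy_set w f (t k / A)) x)%:E))%E.

Lemma measurable_level_term (f : T -> R) (p : R) (t : nat -> R) (k : nat) :
  measurable_fun [set: T] (fun x => ((2 * t k) `^ p)%:E *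
    ((w x)%:E * (\1_(heavy_set w f (t k / A)) x)%:E))%E.
Proof.
apply: emeasurable_funM; first exact: measurable_cst.
apply: emeasurable_funM; first exact: (@measurable_weight _ _ _ w_weight).
apply/measurable_EFinP; apply: measurable_indic; exact: measurable_heavy_set.
Qed.

Lemma level_term_ge0 (f : T -> R) (p : R) (t : nat -> R) (k : nat) (x : T) :
  (0 <= ((2 * t k) `^ p)%:E *
    ((w x)%:E * (\1_(heavy_set w f (t k / A)) x)%:E))%E.
Proof. by rewrite !mule_ge0 ?lee_fin ?powR_ge0// indicE ler0n. Qed.

Lemma measurable_level_sum (f : T -> R) (p : R) (t : nat -> R) :
  measurable_fun [set: T] (level_sum f p t).
Proof.
apply: ge0_emeasurable_sum => [k x _ _|k _]; first exact: level_term_ge0.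
exact: measurable_level_term.
Qed.

(** Up to constants, the truncated weak-type bound turns term k into (t k)^(p-1) times the integral
    of |f| w over the set where t k < 2 A |f|. After exchanging sum and integral, the hypothesis on
    [t] compares the remaining sum of (t k)^(p-1) with |f|^(p-1). *)
Lemma integral_level_sum (f : T -> R) (p G : R) (t : nat -> R) :
  measurable_fun setT f -> 1 < p -> 0 <= G -> (forall k, 0 < t k) ->
  (forall m y, 0 <= y -> \sum_(0 <= k < m)
     ((t k) `^ (p - 1) * (t k < y)%R%:R) <= G * y `^ (p - 1)) ->
  (\int[leb]_x level_sum f p t x <=
    (2 `^ p * (A ^+ 2 * 2) * G * (2 * A) `^ (p - 1))%:E *
    \int[leb]_x (`|f x| `^ p * w x)%:E)%E.
Proof.
move=> mf p1 G0 t0 tG; have A0 := a1_dilation_gt0.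
have mfw := measurable_weighted_fun w_weight mf.
pose B := 2 `^ p * (A ^+ 2 * 2).
have B0 : 0 <= B by rewrite mulr_ge0 ?powR_ge0// mulr_ge0// exprn_ge0// ltW.
rewrite /level_sum (integral_nneseries _ measurableT
  (measurable_level_term f p t) (fun k x _ => level_term_ge0 f p t k x)).
pose E k : set T := [set x | t k / A / 2 < `|f x|].
have mnf : measurable_fun setT (fun x => `|f x|) by exact: measurableT_comp mf.
have mE k : measurable (E k).
  have := mnf measurableT _ (measurable_itv `]t k / A / 2, +oo[).
  rewrite setTI (_ : _ @^-1` _ = E k)//.
  by apply/seteqP; split=> x; rewrite /E/= in_itv/= andbT.
pose F k x : \bar R :=
  ((B * (t k) `^ (p - 1))%:E * ((\1_(E k) x)%:E * (`|f x| * w x)%:E))%E.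
have mEf k : measurable_fun setT (fun x => (\1_(E k) x)%:E * (`|f x| * w x)%:E)%E.
  apply: emeasurable_funM mfw.
  by apply/measurable_EFinP; exact: measurable_indic.
have Ef0 k x : (0 <= (\1_(E k) x)%:E * (`|f x| * w x)%:E)%E.
  by rewrite mule_ge0// ?lee_fin ?mulr_ge0// indicE ler0n.
have Bt0 k : (0 <= (B * (t k) `^ (p - 1))%:E)%E.
  by rewrite lee_fin mulr_ge0 ?powR_ge0.
have mF k : measurable_fun setT (F k).
  exact: emeasurable_funM (measurable_cst _) (mEf k).
have F0 k x : (0 <= F k x)%E by exact: mule_ge0.
apply: (@le_trans _ _ (\sum_(0 <= k <oo) \int[leb]_x F k x)%E).
  apply: lee_nneseries => [k _ _|k _].
    by apply: integral_ge0 => x _; exact: level_term_ge0.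
  rewrite (ge0_integralZl _ measurableT (mEf k) (fun x _ => Ef0 k x) (Bt0 k)).
  have mH := measurable_heavy_set w f (t k / A).
  have mwH : measurable_fun setT
      (fun x => (w x)%:E * (\1_(heavy_set w f (t k / A)) x)%:E)%E.
    apply: emeasurable_funM; first exact: (@measurable_weight _ _ _ w_weight).
    by apply/measurable_EFinP; exact: measurable_indic.
  have wH0 x : (0 <= (w x)%:E * (\1_(heavy_set w f (t k / A)) x)%:E)%E.
    by rewrite mule_ge0 ?lee_fin// indicE ler0n.
  have tp0 : (0 <= ((2 * t k) `^ p)%:E)%E by rewrite lee_fin powR_ge0.
  rewrite (ge0_integralZl _ measurableT mwH (fun x _ => wH0 x) tp0).
  have -> : (\int[leb]_x ((w x)%:E * (\1_(heavy_set w f (t k / A)) x)%:E) =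
      weight_measure w (heavy_set w f (t k / A)))%E.
    rewrite /weight_measure [RHS]integral_mkcond; apply: eq_integral => x _.
    by rewrite patchE indicE; case: (_ \in _); rewrite ?mule1 ?mule0.
  have -> : (\int[leb]_x ((\1_(E k) x)%:E * (`|f x| * w x)%:E) =
      weighted_integral w f (E k))%E.
    rewrite /weighted_integral [RHS]integral_mkcond; apply: eq_integral => x _.
    by rewrite patchE indicE; case: (_ \in _); rewrite ?mul1e ?mul0e.
  have tA0 : 0 < t k / A by rewrite divr_gt0.
  have := weak_type_truncated w_weight C_ge1 w_a1 mf tA0.
  rewrite -/A -/(E k) => h.
  apply: le_trans (_ : ((2 * t k) `^ p)%:E *
      ((A * 2 / (t k / A))%:E * weighted_integral w f (E k)) <= _)%E.
    by apply: lee_wpmul2l h; rewrite lee_fin powR_ge0.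
  rewrite muleA -EFinM le_eqVlt; apply/orP; left; apply/eqP; congr (_%:E * _)%E.
  rewrite powRM// ?(ltW (t0 k))// -(mulr_powRB1 (ltW (t0 k)) (lt_trans ltr01 p1)).
  by rewrite /B; field; rewrite !gt_eqF.
rewrite -(integral_nneseries _ measurableT mF (fun k x _ => F0 k x)).
have K0 : (0 <= (B * G * (2 * A) `^ (p - 1))%:E)%E.
  by rewrite lee_fin mulr_ge0 ?powR_ge0// mulr_ge0.
have mp : measurable_fun setT (fun x => (`|f x| `^ p * w x)%:E).
  apply/measurable_EFinP; apply: measurable_funM.
    exact: measurableT_comp (measurable_powR p) mnf.
  exact/measurable_EFinP/(@measurable_weight _ _ _ w_weight).
have p0 x : (0 <= (`|f x| `^ p * w x)%:E)%E.
  by rewrite lee_fin mulr_ge0 ?powR_ge0.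
rewrite -(ge0_integralZl _ measurableT mp (fun x _ => p0 x) K0).
apply: le_integral_nonmeasurable => x _.
  by apply: nneseries_ge0 => k _ _; exact: F0.
apply: lime_le; first by apply: is_cvg_nneseries => k _ _; exact: F0.
apply: nearW => m.
rewrite /F; under eq_bigr do rewrite -!EFinM.
rewrite sumEFin lee_fin.
apply: (@le_trans _ _ (B * (`|f x| * w x) * \sum_(0 <= k < m)
    ((t k) `^ (p - 1) * (t k < 2 * A * `|f x|)%R%:R))).
  rewrite mulr_sumr; apply: ler_sum => k _.
  rewrite indicE (_ : (x \in E k) = (t k < 2 * A * `|f x|)); last first.
    apply/idP/idP; rewrite inE /E/= !ltr_pdivrMr//;
    by congr (_ < _); ring.
  by rewrite le_eqVlt; apply/orP; left; apply/eqP; ring.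
have y0 : 0 <= 2 * A * `|f x| by rewrite mulr_ge0// mulr_ge0// ltW.
apply: le_trans (_ : B * (`|f x| * w x) * (G * (2 * A * `|f x|) `^ (p - 1)) <= _).
  by apply: ler_wpM2l (tG m _ y0); rewrite mulr_ge0// mulr_ge0.
have -> : (2 * A * `|f x|) `^ (p - 1) = (2 * A) `^ (p - 1) * `|f x| `^ (p - 1).
  by rewrite powRM// mulr_ge0// ltW.
rewrite -(mulr_powRB1 (normr_ge0 (f x)) (lt_trans ltr01 p1)).
by rewrite le_eqVlt; apply/orP; left; apply/eqP; ring.
Qed.

Lemma level_term_le (f : T -> R) (p : R) (t : nat -> R) (k : nat) (x : T) :
  heavy_set w f (t k / A) x ->
  (((2 * t k) `^ p * w x)%:E <= level_sum f p t x)%E.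
Proof.
move=> hx; rewrite /level_sum (nneseriesD1 (n := k))//; last first.
  by move=> j _; exact: level_term_ge0.
rewrite indicE mem_set// mule1 -EFinM leeDl//.
by apply: nneseries_ge0 => j _ _; exact: level_term_ge0.
Qed.

Let up k : R := 2 ^+ k.
Let down k : R := 2 ^- k.+1.

(** A positive finite value of M_mu f lies between a level and its double: an ascending level if the
    value exceeds 1, a descending one otherwise. *)
Lemma weighted_maximal_le_levels (f : T -> R) (p : R) (x : T) :
  measurable_fun setT f -> 1 < p ->
  (weighted_maximal w f x `^ p * (w x)%:E <=
    level_sum f p up x + level_sum f p down x)%E.
Proof.
move=> mf p1; have p0 : 0 < p := lt_trans ltr01 p1.
have ls0 t : (0 <= level_sum f p t x)%E.
  by apply: nneseries_ge0 => j _ _; exact: level_term_ge0.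
have [->|wx] := eqVneq (w x) 0; first by rewrite mule0 adde_ge0.
have {wx} wx0 : 0 < w x by rewrite lt_neqAle eq_sym wx w_ge0.
have hv t : 0 < t -> (t%:E < weighted_maximal w f x)%E ->
  heavy_set w f (t / A) x by exact: lt_weighted_maximal.
have v0 : (0 <= weighted_maximal w f x)%E.
  have x1 : [set c : V * R | 0 < c.2 /\ cubep c x] (x : V, 1).
    by split=> //; exact: cube_nonempty.
  apply: le_trans (ereal_sup_ubound (imageP _ x1)).
  by rewrite mule_ge0 ?weighted_integral_ge0// lee_fin invr_ge0 mass_ge0.
move: hv v0; case: (weighted_maximal w f x) => [v| |]// hv; last first.
  move=> _; rewrite (_ : level_sum f p up x = +oo%E).
    by rewrite addye ?leey// -ltNye (lt_le_trans _ (ls0 _)).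
  (* For an infinite value every ascending level is reached, and since w x > 0 the term of a large
     [k] exceeds the given [r]. *)
  apply: eq_infty => r; pose k := Num.bound `|r / w x|.
  have k1 : 1 <= 2 ^+ k.+1 :> R by rewrite exprn_ege1// ler1n.
  have ub : r <= 2 ^+ k.+1 * w x.
    rewrite -ler_pdivrMr//; apply: le_trans (ler_norm _) _.
    apply: le_trans (ltW (archi_boundP (normr_ge0 _))) _.
    by rewrite -natrX ler_nat ltnW// (ltn_trans (ltnSn _))// ltn_expl.
  apply: le_trans (level_term_le (t := up) (k := k) _ _).
    rewrite lee_fin (le_trans ub)// ler_wpM2r// /up -exprS.
    by apply: le1r_powR => //; exact: ltW.
  by apply: hv; rewrite ?ltry// exprn_gt0.
rewrite lee_fin poweR_EFin -EFinM => v0.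
have [->|vn0] := eqVneq v 0.
  by rewrite powR0 ?gt_eqF// mul0r adde_ge0.
have {vn0} v_gt0 : 0 < v by rewrite lt_neqAle eq_sym vn0.
have step t k : 0 < t k -> t k < v -> v <= 2 * t k ->
    ((v `^ p * w x)%:E <= level_sum f p t x)%E.
  move=> t0 tv vt; apply: le_trans (level_term_le _ (hv _ t0 _)).
    rewrite lee_fin ler_wpM2r// ge0_ler_powR ?nnegrE ?(ltW p0)//.
    exact: le_trans v0 vt.
  by rewrite lte_fin.
have [v1|v1] := ltP 1 v.
  have [k /andP[k1 k2]] := exists_level_up v1.
  apply: le_trans (step up k _ k1 _) _; rewrite ?exprn_gt0//.
    by rewrite -exprS.
  by rewrite leeDl.
have /exists_level_down[k /andP[k1 k2]] : 0 < v <= 1 by rewrite v_gt0.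
apply: le_trans (step down k _ k1 k2) _; first by rewrite invr_gt0 exprn_gt0.
by rewrite leeDr.
Qed.

(** The estimate is put on a measurable majorant [Phi], so that later uses can pull out constants
    and deduce finiteness almost everywhere. *)
Theorem weighted_maximal_strong_type (p : R) : 1 < p ->
  exists K : R, 0 <= K /\ forall f : T -> R, measurable_fun setT f ->
    exists Phi : T -> \bar R, [/\ measurable_fun [set: T] Phi,
      (forall x, 0 <= Phi x)%E,
      (forall x, weighted_maximal w f x `^ p * (w x)%:E <= Phi x)%E &
      (\int[leb]_x Phi x <= K%:E * \int[leb]_x (`|f x| `^ p * w x)%:E)%E].
Proof.
move=> p1; have s0 : 0 < p - 1 by rewrite subr_gt0.
pose G : R := 2 `^ (p - 1) / (2 `^ (p - 1) - 1).
have G0 : 0 <= G.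
  rewrite divr_ge0 ?powR_ge0// subr_ge0.
  have : 1 `^ (p - 1) <= 2 `^ (p - 1) :> R.
    by apply: ge0_ler_powR; rewrite ?nnegrE ?(ltW s0)//; lra.
  by rewrite powR1.
pose K := 2 `^ p * (A ^+ 2 * 2) * G * (2 * A) `^ (p - 1).
have A0 := a1_dilation_gt0.
have K0 : 0 <= K.
  by rewrite mulr_ge0 ?powR_ge0// mulr_ge0// mulr_ge0 ?powR_ge0// mulr_ge0 ?exprn_ge0// ltW.
exists (K + K); split=> [|f mf]; first exact: addr_ge0.
have ls0 t x : (0 <= level_sum f p t x)%E.
  by apply: nneseries_ge0 => j _ _; exact: level_term_ge0.
have ml := measurable_level_sum f p.
exists (fun x => level_sum f p up x + level_sum f p down x)%E; split.
- exact: emeasurable_funD (ml _) (ml _).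
- by move=> x; exact: adde_ge0.
- by move=> x; exact: weighted_maximal_le_levels.
rewrite (ge0_integralD _ measurableT (fun x _ => ls0 _ x) (ml _)
  (fun x _ => ls0 _ x) (ml _)).
rewrite EFinD ge0_muleDl ?lee_fin//; apply: leeD.
  apply: integral_level_sum => // [k|m y y0]; first by rewrite exprn_gt0.
  exact: geometric_levels_up.
apply: integral_level_sum => // [k|m y y0]; first by rewrite invr_gt0 exprn_gt0.
exact: geometric_levels_down.
Qed.

End strong_type.

(** * Testing on cubes *)

Section cube_averages.
Context {R : realType} {n : nat}.
Local Notation V := 'rV[R]_n.+1.
Local Notation T := (Rn R n).
Local Notation leb := (@lebn R n).
Local Notation cubep c := (cube c.1 c.2 : set T).
Local Notation volume := (@volume R n).

Lemma is_cube_cube (c : V * R) : 0 < c.2 -> is_cube (cubep c).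
Proof. by move=> c0; exists c.1, c.2. Qed.

Lemma is_cubeP (Q : set T) : is_cube Q -> exists2 c : V * R, 0 < c.2 & Q = cubep c.
Proof. by move=> [a [l [l0 ->]]]; exists (a, l). Qed.

Lemma integral_cst_cube (c : V * R) (k : R) : 0 < c.2 ->
  (\int[leb]_(x in cubep c) k%:E = (k * volume c.2)%:E)%E.
Proof.
move=> c0; rewrite (integral_cst _ (measurable_cube _ _)).
have -> : (k%:E * leb (cubep c) = (k * volume c.2)%:E)%E by rewrite lebn_cube.
by [].
Qed.

Lemma integrable_cst_cube (c : V * R) (k : R) : 0 < c.2 ->
  leb.-integrable (cubep c) (fun=> k%:E).
Proof.
move=> c0; apply/integrableP; split; first exact: measurable_cst.
by rewrite /= (integral_cst_cube _ c0) ltry.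
Qed.

Context (w : T -> R) (w_weight : is_weight w).

Lemma inve_lebn_cube (c : V * R) : 0 < c.2 ->
  (leb (cubep c))^-1%E = ((volume c.2)^-1)%:E.
Proof.
by move=> c0; rewrite lebn_cube// inver gt_eqF// (volume_gt0 w_weight).
Qed.

Lemma cube_abs_meanE (f : T -> R) (c : V * R) : 0 < c.2 ->
  cube_abs_mean f (cubep c) =
    (((volume c.2)^-1)%:E * \int[leb]_(x in cubep c) `|f x|%:E)%E.
Proof. by move=> c0; rewrite /cube_abs_mean inve_lebn_cube. Qed.

Lemma cube_meanE (f : T -> R) (c : V * R) : 0 < c.2 ->
  cube_mean f (cubep c) = (volume c.2)^-1 * (\int[leb]_(x in cubep c) f x).
Proof. by move=> c0; rewrite /cube_mean lebn_cube. Qed.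

Lemma cube_abs_mean_ge0 (f : T -> R) (c : V * R) : 0 < c.2 ->
  (0 <= cube_abs_mean f (cubep c))%E.
Proof.
move=> c0; rewrite cube_abs_meanE// mule_ge0 ?integral_ge0//.
by rewrite lee_fin invr_ge0 ltW// (volume_gt0 w_weight).
Qed.

Lemma cube_abs_mean_indic_le (c d : V * R) : 0 < c.2 -> 0 < d.2 ->
  (cube_abs_mean (\1_(cubep c)) (cubep d) <= 1)%E.
Proof.
move=> c0 d0; have v0 := volume_gt0 w_weight d0.
rewrite cube_abs_meanE// lee_pdivrMl// mule1.
apply: (@le_trans _ _ (\int[leb]_(x in cubep d) (cst 1%E) x)%E).
  apply: le_integral_nonmeasurable => x _; rewrite lee_fin//.
  by rewrite indicE; case: (_ \in _); rewrite /= ?normr1 ?normr0.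
rewrite integral_cst; last exact: measurable_cube.
by rewrite mul1e [leLHS](lebn_cube d.1 d0).
Qed.

Lemma maximal_indic (c : V * R) (x : T) : 0 < c.2 -> cubep c x ->
  maximal (\1_(cubep c)) x = 1%E.
Proof.
move=> c0 cx; apply/eqP; rewrite eq_le; apply/andP; split.
  apply: ge_ereal_sup => _ [Q [/is_cubeP[d d0 ->] dx] <-].
  exact: cube_abs_mean_indic_le.
apply: ereal_sup_ubound; exists (cubep c); first by split => //; exact: is_cube_cube.
rewrite cube_abs_meanE// (eq_integral (cst 1%E)); last first.
  by move=> y yc; rewrite indicE yc normr1.
rewrite integral_cst; last exact: measurable_cube.
have v0 := volume_gt0 w_weight c0.
have -> : (1 * leb (cubep c) = (volume c.2)%:E)%E by rewrite mul1e lebn_cube.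
by rewrite -EFinM mulVf// gt_eqF.
Qed.

Lemma integral_restricted (b : T -> R) (A B : set T) :
  (\int[leb]_(x in A) `|b x * \1_B x|%:E = \int[leb]_(x in A `&` B) `|b x|%:E)%E.
Proof.
rewrite integral_mkcondr; apply: eq_integral => x _.
by rewrite patchE indicE; case: (_ \in _); rewrite ?mulr1// mulr0 normr0.
Qed.

(* A cube meeting [Q] can be shifted into [Q], or is larger than [Q]. *)
Lemma maximal_restricted (b : T -> R) (c : V * R) (x : T) :
  locally_integrable_n b -> 0 < c.2 -> cubep c x ->
  maximal (fun y => b y * \1_(cubep c) y) x = local_maximal (cubep c) b x.
Proof.
move=> [mb _] c0 cx.
have mab D : measurable_fun D (fun y => `|b y|%:E).
  apply: measurable_funTS; apply/measurable_EFinP.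
  exact: measurableT_comp mb.
have le_int (A B : set T) : measurable A -> measurable B -> A `<=` B ->
    (\int[leb]_(y in A) `|b y|%:E <= \int[leb]_(y in B) `|b y|%:E)%E.
  move=> mA mB; apply: (ge0_subset_integral _ mA mB (@mab _)) => y _.
  by rewrite lee_fin.
have mc d : measurable (cubep d) by exact: measurable_cube.
apply/eqP; rewrite eq_le; apply/andP; split.
  apply: ge_ereal_sup => _ [Q [/is_cubeP[d d0 ->] dx] <-].
  rewrite cube_abs_meanE// integral_restricted.
  have [le|lt] := leP c.2 d.2.
    apply: le_trans (ereal_sup_ubound _) => /=; last first.
      exists (cubep c); last by [].
      by split => //; exact: is_cube_cube.
    rewrite cube_abs_meanE//; apply: lee_pmul.
    - by rewrite lee_fin invr_ge0 ltW// (volume_gt0 w_weight).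
    - by apply: integral_ge0 => y _; rewrite lee_fin.
    - rewrite lee_fin lef_pV2 ?posrE ?(volume_gt0 w_weight)//.
      rewrite ler_pM2l ?(unit_volume_gt0 w_weight)//.
      by apply: lerXn2r => //; rewrite nnegrE ltW.
    - by apply: le_int (@subIsetr _ _ _); [exact: measurableI|exact: mc].
  (* The corner of [d] is clamped, coordinate by coordinate, to the positions from which a side
     [d.2] fits in [c]; the common part of [d] and [c] stays in the shifted cube. *)
  pose a : V := \row_i (if d.1 ord0 i <= c.1 ord0 i then c.1 ord0 i
    else if d.1 ord0 i + d.2 <= c.1 ord0 i + c.2 then d.1 ord0 i
    else c.1 ord0 i + c.2 - d.2).
  have dca : cubep d `&` cubep c `<=` cube a d.2.
    move=> y [dy cy] i; have := dy i; have := cy i; rewrite mxE.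
    case: (leP (d.1 ord0 i) (c.1 ord0 i)) => ?;
      [|case: (leP (d.1 ord0 i + d.2) (c.1 ord0 i + c.2)) => ?];
      move=> /andP[? ?] /andP[? ?]; lra.
  have ac : (cube a d.2 : set T) `<=` cubep c.
    move=> y ay i; have := ay i; rewrite mxE.
    case: (leP (d.1 ord0 i) (c.1 ord0 i)) => ?;
      [|case: (leP (d.1 ord0 i + d.2) (c.1 ord0 i + c.2)) => ?];
      move=> /andP[? ?]; lra.
  apply: le_trans (ereal_sup_ubound _) => /=; last first.
    exists (cube a d.2); last by [].
    split=> //; first by exists a, d.2.
    exact: dca.
  rewrite (@cube_abs_meanE b (a, d.2))//=; apply: lee_wpmul2l.
    by rewrite lee_fin invr_ge0 ltW// (volume_gt0 w_weight).
  by apply: le_int dca; [exact: measurableI|exact: (mc (a, d.2))].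
apply: ge_ereal_sup => _ [Q [/is_cubeP[d d0 ->] dx dc] <-].
apply: ereal_sup_ubound; exists (cubep d).
  by split => //; exact: is_cube_cube.
by rewrite !cube_abs_meanE// integral_restricted; congr (_ * integral _ _ _)%E;
  apply/setIidl.
Qed.

End cube_averages.

(** * Testing the bounded commutator on indicators of cubes *)

Section bounded_to_testing.
Context {R : realType} {n : nat}.
Local Notation V := 'rV[R]_n.+1.
Local Notation T := (Rn R n).
Local Notation leb := (@lebn R n).
Local Notation cubep c := (cube c.1 c.2 : set T).

Context (w : T -> R) (w_weight : is_weight w) (C : R) (C_ge1 : 1 <= C)
  (w_a1 : {ae leb, forall x, a1_point C w x}).


Lemma weighted_norm_indic (p : R) (c : V * R) : 0 < p ->
  weighted_norm p w (EFin \o \1_(cubep c)) = ((mass w c) `^ p^-1)%:E.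
Proof.
move=> p0; rewrite /weighted_norm -poweR_EFin; congr (_ `^ _)%E.
have -> : (mass w c)%:E = weight_measure w (cubep c) by rewrite weight_measure_cube.
rewrite /weight_measure [RHS]integral_mkcond; apply: eq_integral => x _.
rewrite patchE [(_ \o _) x]/= abse_EFin poweR_EFin indicE.
case: (_ \in _) => /=.
  by rewrite normr1 powR1 mul1e.
by rewrite normr0 powR0 ?gt_eqF// mul0e.
Qed.

Lemma weighted_L_indic (p : R) (c : V * R) : 0 < p ->
  weighted_L p w (\1_(cubep c)).
Proof.
move=> p0; split; last by rewrite weighted_norm_indic// ltry.
exact: measurable_indic (measurable_cube _ _).
Qed.

Definition testing_integral (b : T -> R) (q : R) (Q : set T) : \bar R :=
  (\int[leb]_(x in Q)
     (`|(b x)%:E - local_maximal Q b x| `^ q * (w x `^ (1 - q))%:E))%E.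

Lemma testing_integral_ge0 (b : T -> R) (q : R) (Q : set T) :
  (0 <= testing_integral b q Q)%E.
Proof.
by apply: integral_ge0 => x _; rewrite mule_ge0 ?poweR_ge0// lee_fin powR_ge0.
Qed.

Lemma testing_integral_le (b : T -> R) (q : R) (c : V * R) :
  locally_integrable_n b -> 0 < c.2 ->
  (testing_integral b q (cubep c) <=
    \int[leb]_x (`|commutator_maximal b (\1_(cubep c)) x| `^ q *
                 (w x `^ (1 - q))%:E))%E.
Proof.
move=> b_loc c0; rewrite /testing_integral integral_mkcond.
have h0 x y : (0 <= `|y| `^ q * (w x `^ (1 - q))%:E)%E.
  by rewrite mule_ge0 ?poweR_ge0// lee_fin powR_ge0.
apply: le_integral_nonmeasurable => x _; rewrite patchE.
  by case: ifP => // _; exact: h0.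
case: ifPn => [/set_mem cx|_]; last exact: h0.
rewrite /commutator_maximal (maximal_indic w_weight c0 cx) mule1.
by rewrite (maximal_restricted w_weight b_loc c0 cx).
Qed.

(** The indicator of Q has norm mu(Q)^(1/p), and restricting the norm of its image to Q gives the
    testing integral. The powers of mu(Q) cancel since 1/p = al + 1/q. *)
Lemma testing_of_bounded (b : T -> R) (al p q : R) :
  locally_integrable_n b -> 0 < p -> 0 < q -> q^-1 = p^-1 - al ->
  bounded_operator (commutator_maximal b) p w q (fun x => w x `^ (1 - q)) ->
  exists C0 : R, 0 < C0 /\ forall c : V * R, 0 < c.2 ->
    (((weight_measure w (cubep c) `^ al)^-1 *
      ((weight_measure w (cubep c))^-1 *
       testing_integral b q (cubep c)) `^ q^-1) <= C0%:E)%E.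
Proof.
move=> b_loc p0 q0 pq [C0 [C00 bdd]]; exists C0; split => // c c0.
have [_] := bdd _ (weighted_L_indic c p0).
rewrite weighted_norm_indic// /weighted_norm => h.
have m0 := mass_gt0 w_weight C_ge1 w_a1 c0.
have wE : weight_measure w (cubep c) = (mass w c)%:E by rewrite weight_measure_cube.
rewrite wE poweR_EFin !inver !gt_eqF ?powR_gt0//.
set I := testing_integral _ _ _.
have I0 : (0 <= I)%E by exact: testing_integral_ge0.
have qV0 : 0 <= q^-1 by rewrite invr_ge0 ltW.
have IC : (I `^ q^-1 <= C0%:E * (mass w c `^ p^-1)%:E)%E.
  apply: (le_trans _ h).
  apply: (gt0_ler_poweR qV0 _ _ (testing_integral_le q b_loc c0)).
    by rewrite in_itv/= leey andbT.
  rewrite in_itv/= leey andbT; apply: integral_ge0 => x _.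
  by rewrite mule_ge0 ?poweR_ge0// lee_fin powR_ge0.
rewrite poweRM ?lee_fin ?invr_ge0 ?(ltW m0)// muleA.
apply: le_trans (lee_wpmul2l _ IC) _.
  by rewrite mule_ge0 ?poweR_ge0// lee_fin invr_ge0 powR_ge0.
rewrite poweR_EFin -!EFinM lee_fin le_eqVlt; apply/orP; left; apply/eqP.
set m := mass w c in m0 *.
have mV r : (m `^ r)^-1 = m `^ (- r) by rewrite powRN.
have -> : m^-1 `^ q^-1 = m `^ (- q^-1).
  by rewrite -powR_inv1 ?ltW// -powRrM mulN1r.
have mD r s : m `^ r * m `^ s = m `^ (r + s).
  by rewrite powRD // (gt_eqF m0) implybT.
rewrite mV mD mulrCA mD.
rewrite [X in _ `^ X](_ : _ = 0) ?powRr0 ?mulr1// pq; ring.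
Qed.

End bounded_to_testing.

(* A substitute for Hoelder's inequality, to be integrated and optimized in [t]:
   [u <= 1 + u ^ q] for [u = s / (t * v)]. *)
Lemma le_add_powR {R : realType} (q s t v : R) : 1 <= q -> 0 <= s -> 0 < t -> 0 < v ->
  s <= t * v + t `^ (1 - q) * (s `^ q * v `^ (1 - q)).
Proof.
move=> q1 s0 t0 v0; have tv0 : 0 < t * v by exact: mulr_gt0.
have q0 : 0 < q := lt_le_trans ltr01 q1.
have [le|lt] := leP s (t * v).
  by rewrite (le_trans le)// lerDl !mulr_ge0 ?powR_ge0.
have sp0 : 0 < s := lt_trans tv0 lt.
rewrite (le_trans _ (_ : t `^ (1 - q) * (s `^ q * v `^ (1 - q)) <= _))//; last first.
  by rewrite lerDr ltW.
have pB x : 0 < x -> x `^ (1 - q) = x / x `^ q.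
  by move=> x0; rewrite powRB ?(gt_eqF x0) ?implybT// powRr1 ?ltW.
have -> : t `^ (1 - q) * (s `^ q * v `^ (1 - q)) = t * v * (s / (t * v)) `^ q.
  rewrite !pB// powRM ?invr_ge0 ?(ltW tv0)//.
  rewrite -(powR_inv1 (ltW tv0)) -powRrM mulN1r powRN powRM ?(ltW t0) ?(ltW v0)//.
  by field; rewrite !gt_eqF ?powR_gt0.
have h : s / (t * v) <= (s / (t * v)) `^ q.
  by apply: le1r_powR => //; rewrite ler_pdivlMr// mul1r ltW.
by rewrite mulrC -ler_pdivrMr.
Qed.

(** * From the testing condition to the Lipschitz condition and nonnegativity *)

Section testing_to_lipschitz.
Context {R : realType} {n : nat}.
Local Notation V := 'rV[R]_n.+1.
Local Notation T := (Rn R n).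
Local Notation leb := (@lebn R n).
Local Notation cubep c := (cube c.1 c.2 : set T).
Local Notation volume := (@volume R n).

Context (w : T -> R) (w_weight : is_weight w) (C : R) (C_ge1 : 1 <= C)
  (w_a1 : {ae leb, forall x, a1_point C w x}).

Let w_ge0 x : 0 <= w x. Proof. by case: w_weight. Qed.

Context (b : T -> R) (b_loc : locally_integrable_n b) (al q C0 : R)
  (al_gt0 : 0 < al) (q_gt1 : 1 < q) (C0_gt0 : 0 < C0).

Let q_gt0 : 0 < q. Proof. exact: lt_trans ltr01 q_gt1. Qed.

Context (testing : forall c : V * R, 0 < c.2 ->
    (((weight_measure w (cubep c) `^ al)^-1 *
      ((weight_measure w (cubep c))^-1 *
       testing_integral w b q (cubep c)) `^ q^-1) <= C0%:E)%E).

Lemma testing_integral_bound (c : V * R) : 0 < c.2 ->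
  (testing_integral w b q (cubep c) <=
    (mass w c * (C0 * mass w c `^ al) `^ q)%:E)%E.
Proof.
move=> c0; have m0 := mass_gt0 w_weight C_ge1 w_a1 c0.
have wE : weight_measure w (cubep c) = (mass w c)%:E by rewrite weight_measure_cube.
have := testing c0; rewrite wE poweR_EFin !inver !gt_eqF ?powR_gt0//.
rewrite lee_pdivrMl ?powR_gt0// -EFinM => h.
set I := testing_integral _ _ _ _ in h *.
have I0 : (0 <= I)%E by exact: testing_integral_ge0.
have mI0 : (0 <= (mass w c)^-1%:E * I)%E.
  by rewrite mule_ge0// lee_fin invr_ge0 ltW.
have := gt0_ler_poweR (ltW q_gt0) _ _ h.
rewrite -poweRrM mulVf ?gt_eqF// poweRe1// poweR_EFin => {}h.
rewrite EFinM -lee_pdivrMl// mulrC; apply: h.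
  by rewrite in_itv/= leey andbT poweR_ge0.
by rewrite in_itv/= leey andbT lee_fin mulr_ge0 ?powR_ge0// ltW.
Qed.

Lemma measurable_b (D : set T) : measurable_fun D b.
Proof. by apply: measurable_funTS; exact: b_loc.1. Qed.

(** Where [k] is below the local maximal function, the positive part of k - b is at most |b - M_Q
    b|. The testing bound lives in L^q(w^(1-q)), and [le_add_powR] with v = w x brings it down to
    L^1. *)
Lemma below_local_maximal (c : V * R) (k : R) : 0 < c.2 ->
  (forall x, cubep c x -> k%:E <= local_maximal (cubep c) b x)%E ->
  (\int[leb]_(x in cubep c) (Num.max (k - b x) 0)%:E <=
    (2 * C0 * (mass w c * mass w c `^ al))%:E)%E.
Proof.
move=> c0 hk; have m0 := mass_gt0 w_weight C_ge1 w_a1 c0.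
have mQ := measurable_cube c.1 c.2.
pose s x := Num.max (k - b x) 0.
have s0 x : 0 <= s x by rewrite le_max lexx orbT.
have ms D : measurable_fun D s.
  apply: measurable_maxr; last exact: measurable_cst.
  exact: measurable_funB (measurable_cst _) (@measurable_b D).
(* With this [t], both terms of [le_add_powR] integrate to at most t mu(Q), whence the factor 2. *)
pose t := C0 * mass w c `^ al.
have t0 : 0 < t by rewrite mulr_gt0 ?powR_gt0.
have mw D : measurable_fun D w by apply: measurable_funTS; case: w_weight => -[].
pose g x := s x `^ q * w x `^ (1 - q).
have g0 x : 0 <= g x by rewrite mulr_ge0 ?powR_ge0.
have mg D : measurable_fun D (EFin \o g).
  apply/measurable_EFinP; apply: measurable_funM.
    exact: measurableT_comp (measurable_powR q) (@ms D).
  exact: measurableT_comp (measurable_powR (1 - q)) (@mw D).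
have gI : (\int[leb]_(x in cubep c) (g x)%:E <= testing_integral w b q (cubep c))%E.
  apply: le_integral_nonmeasurable => x cx; rewrite ?lee_fin//.
  rewrite /g EFinM -poweR_EFin lee_wpmul2r ?lee_fin ?powR_ge0//.
  have sle : ((s x)%:E <= `|(b x)%:E - local_maximal (cubep c) b x|)%E.
    have := hk x cx; rewrite /s; case: (local_maximal _ _ _) => [r| |]//=.
      rewrite lee_fin => kr; rewrite lee_fin ge_max normr_ge0 andbT.
      by rewrite distrC (le_trans _ (ler_norm _))// lerD2r.
    by move=> _; rewrite leey.
  apply: (gt0_ler_poweR (ltW q_gt0) _ _ sle).
    by rewrite in_itv/= leey andbT lee_fin.
  by rewrite in_itv/= leey andbT.
have mtw D : measurable_fun D (fun x => (t * w x)%:E).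
  by apply/measurable_EFinP; exact: measurable_funM (measurable_cst _) (@mw D).
have mtg D : measurable_fun D (fun x => (t `^ (1 - q))%:E * (g x)%:E)%E.
  exact: emeasurable_funM (measurable_cst _) (@mg D).
have tw0 x : (0 <= (t * w x)%:E)%E by rewrite lee_fin mulr_ge0// ltW.
have tq0 : (0 <= (t `^ (1 - q))%:E)%E by rewrite lee_fin powR_ge0.
have tg0 x : (0 <= (t `^ (1 - q))%:E * (g x)%:E)%E by rewrite mule_ge0// lee_fin.
have mms : measurable_fun (cubep c) (fun x => (s x)%:E) by exact/measurable_EFinP/ms.
apply: (@le_trans _ _ (\int[leb]_(x in cubep c)
   ((t * w x)%:E + (t `^ (1 - q))%:E * (g x)%:E))%E).
  apply: (ae_ge0_le_integral mQ _ mms _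
    (emeasurable_funD (@mtw (cubep c)) (@mtg (cubep c)))).
  - by move=> x _; rewrite lee_fin.
  - by move=> x _; rewrite adde_ge0.
  - apply: filterS (weight_gt0 w_weight C_ge1 w_a1) => x wx _.
    by rewrite -EFinM -EFinD lee_fin le_add_powR// ltW.
rewrite (ge0_integralD _ mQ (fun x _ => tw0 x) (@mtw _) (fun x _ => tg0 x) (@mtg _)).
rewrite (ge0_integralZl _ mQ (@mg _) _ tq0); last by move=> x _; rewrite lee_fin.
have -> : (\int[leb]_(x in cubep c) (t * w x)%:E = (t * mass w c)%:E)%E.
  under eq_integral do rewrite EFinM.
  rewrite (ge0_integralZl _ mQ (@measurable_weight_in _ _ _ w_weight _)).
  - by rewrite -/(weight_measure w _) weight_measure_cube.
  - by move=> x _; rewrite lee_fin.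
  - by rewrite lee_fin ltW.
apply: le_trans (_ : (t * mass w c)%:E + (t `^ (1 - q))%:E * (mass w c * t `^ q)%:E <= _)%E.
  by apply: leeD2l; apply: lee_wpmul2l => //; apply: le_trans gI (testing_integral_bound c0).
rewrite -EFinM -EFinD lee_fin mulrCA -powRD; last by rewrite (gt_eqF t0) implybT.
rewrite subrK powRr1 ?(ltW t0)// /t le_eqVlt; apply/orP; left; apply/eqP; ring.
Qed.

Let b_int (c : V * R) : leb.-integrable (cubep c) (EFin \o b).
Proof. exact: locally_integrable_cube. Qed.

Lemma integral_sub_cube (c : V * R) (k : R) : 0 < c.2 ->
  (\int[leb]_(x in cubep c) (k - b x)%:E =
    (k * volume c.2 - \int[leb]_(x in cubep c) b x)%:E)%E.
Proof.
move=> c0; have mQ := measurable_cube c.1 c.2.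
under eq_integral do rewrite EFinB.
rewrite (integralB mQ (integrable_cst_cube k c0) (b_int c)) integral_cst_cube//.
rewrite /Rintegral EFinB; congr (_ - _)%E.
by rewrite fineK// integrable_fin_num.
Qed.

Let absb_int (c : V * R) : leb.-integrable (cubep c) (EFin \o (fun x => `|b x|)).
Proof. exact: (integrable_abse (b_int c)). Qed.

Let absb_intE (c : V * R) : (\int[leb]_(x in cubep c) `|b x|%:E =
  (\int[leb]_(x in cubep c) `|b x|)%:E)%E.
Proof.
rewrite /Rintegral fineK//.
exact: (integrable_fin_num (measurable_cube _ _) (absb_int c)).
Qed.

Lemma abs_mean_le_local_maximal (c : V * R) (x : T) : 0 < c.2 -> cubep c x ->
  (((volume c.2)^-1 * \int[leb]_(y in cubep c) `|b y|)%:E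
    <= local_maximal (cubep c) b x)%E.
Proof.
move=> c0 cx; apply: ereal_sup_ubound; exists (cubep c).
  by split => //; exact: is_cube_cube.
by rewrite (cube_abs_meanE w_weight)// EFinM absb_intE.
Qed.

Lemma mean_le_abs_mean (c : V * R) : 0 < c.2 -> cube_mean b (cubep c) <=
  (volume c.2)^-1 * \int[leb]_(y in cubep c) `|b y|.
Proof.
move=> c0; rewrite cube_meanE// ler_pM2l ?invr_gt0 ?(volume_gt0 w_weight)//.
apply: le_trans (ler_norm _) _.
exact: le_normr_Rintegral (measurable_cube _ _) (b_int c).
Qed.

Lemma oscillation_bound (c : V * R) : 0 < c.2 ->
  (\int[leb]_(x in cubep c) `|b x - cube_mean b (cubep c)|%:E <=
    (4 * C0 * (mass w c * mass w c `^ al))%:E)%E.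
Proof.
move=> c0; set k := cube_mean _ _; have mQ := measurable_cube c.1 c.2.
have hk x : cubep c x -> (k%:E <= local_maximal (cubep c) b x)%E.
  move=> cx; apply: le_trans (abs_mean_le_local_maximal c0 cx).
  by rewrite lee_fin mean_le_abs_mean.
have kb0 : (\int[leb]_(x in cubep c) (k - b x)%:E = 0)%E.
  rewrite integral_sub_cube// /k cube_meanE// mulrAC mulVf ?mul1r ?subrr//.
  by rewrite gt_eqF// (volume_gt0 w_weight).
have kb_int : leb.-integrable (cubep c) (EFin \o (fun x => k - b x)).
  exact: (integrableB mQ (integrable_cst_cube k c0) (b_int c)).
have abs_int : leb.-integrable (cubep c)
    (EFin \o (fun x => `|b x - cube_mean b (cubep c)|)).
  rewrite (_ : _ \o _ = abse \o (EFin \o (fun x => k - b x))).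
    exact: (integrable_abse kb_int).
  by apply/funext => x /=; rewrite distrC.
have mmax : measurable_fun (cubep c) (fun x => (Num.max (k - b x) 0)%:E).
  apply/measurable_EFinP; apply: measurable_maxr; last exact: measurable_cst.
  exact: measurable_funB (measurable_cst _) (@measurable_b _).
(* Adding the zero integral of k - b to that of |b - k| leaves twice the positive part of k - b. *)
rewrite -[leLHS]adde0 -kb0 -(integralD mQ abs_int kb_int).
rewrite (eq_integral (fun x => 2%:E * (Num.max (k - b x) 0)%:E)%E); last first.
  move=> x _; rewrite /= -EFinD -EFinM; congr EFin; rewrite -/k.
  case: (leP (k - b x) 0) => h.
    have bk : 0 <= b x - k by lra.
    by rewrite ger0_norm//; ring.
  by rewrite distrC gtr0_norm//; ring.
rewrite (ge0_integralZl _ mQ mmax)//; last by move=> x _; rewrite lee_fin le_max lexx orbT.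
rewrite (_ : 4 * _ * _ = 2 * (2 * C0 * (mass w c * mass w c `^ al))); last by ring.
by rewrite [leRHS]EFinM; apply: lee_wpmul2l; rewrite ?lee_fin//; exact: below_local_maximal.
Qed.

(** For [k] the mean of |b|, the function |b| and the constant [k] have the same integral over the
    cube, so |b| - b may be replaced by k - b under the integral. *)
Lemma negative_part_bound (c : V * R) : 0 < c.2 ->
  (\int[leb]_(x in cubep c) (`|b x| - b x)%:E <=
    (2 * C0 * (mass w c * mass w c `^ al))%:E)%E.
Proof.
move=> c0; have mQ := measurable_cube c.1 c.2.
pose k := (volume c.2)^-1 * \int[leb]_(y in cubep c) `|b y|.
apply: le_trans (below_local_maximal (k := k) c0 _); last first.
  by move=> x cx; exact: abs_mean_le_local_maximal.
under eq_integral do rewrite EFinB.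
rewrite (integralB mQ (absb_int c) (b_int c)) absb_intE.
have v0 := volume_gt0 w_weight c0.
rewrite (_ : _ - _ = \int[leb]_(x in cubep c) (k - b x)%:E)%E; last first.
  rewrite integral_sub_cube// /k mulrAC mulVf ?gt_eqF// mul1r EFinB.
  by congr (_ - _)%E; rewrite /Rintegral fineK// integrable_fin_num.
have kb_int : leb.-integrable (cubep c) (EFin \o (fun x => k - b x)).
  exact: (integrableB mQ (integrable_cst_cube k c0) (b_int c)).
have max_int : leb.-integrable (cubep c) (EFin \o (fun x => Num.max (k - b x) 0)).
  have mmax : measurable_fun (cubep c) (fun x => (Num.max (k - b x) 0)%:E).
    apply/measurable_EFinP; apply: measurable_maxr; last exact: measurable_cst.
    exact: measurable_funB (measurable_cst _) (@measurable_b _).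
  apply: (le_integrable mQ mmax _ kb_int) => x _; rewrite /= lee_fin.
  by case: (leP (k - b x) 0) => // h; rewrite normr0.
by apply: (le_integral mQ kb_int max_int) => x _; rewrite lee_fin le_max lexx.
Qed.

Lemma testing_lipschitz :
  exists K : R, forall Q, is_cube Q ->
    ((weight_measure w Q `^ (1 + al))^-1 *
      \int[leb]_(x in Q) `|b x - cube_mean b Q|%:E <= K%:E)%E.
Proof.
exists (4 * C0) => _ /is_cubeP[c c0 ->].
have m0 := mass_gt0 w_weight C_ge1 w_a1 c0.
have wE : weight_measure w (cubep c) = (mass w c)%:E by rewrite weight_measure_cube.
rewrite wE poweR_EFin inver gt_eqF ?powR_gt0// lee_pdivrMl ?powR_gt0//.
apply: le_trans (oscillation_bound c0) _; rewrite -EFinM lee_fin.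
rewrite powRD ?(gt_eqF m0) ?implybT// powRr1 ?(ltW m0)//.
by rewrite le_eqVlt; apply/orP; left; apply/eqP; ring.
Qed.

Lemma testing_nonneg : {ae leb, forall x, 0 <= b x}.
Proof.
apply: negligible_centered_cube => k.
pose B : V * R := (const_mx (- k.+1%:R), k.+1%:R *+ 2).
have B0 : 0 < B.2 by rewrite pmulrn_lgt0.
pose h x : \bar R := (`|b x| - b x)%:E.
have h0 x : (0 <= h x)%E by rewrite lee_fin subr_ge0 ler_norm.
have mh D : measurable_fun D h.
  apply/measurable_EFinP; apply: measurable_funB (@measurable_b D).
  exact: measurableT_comp (@measurable_b D).
have mB : measurable (cubep B) := measurable_cube _ _.
have hB0 : (\int[leb]_(x in cubep B) h x = 0)%E.
  apply/eqP; rewrite eq_le integral_ge0// andbT.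
  apply/lee_addgt0Pr => e e0; rewrite add0e.
  have e1 : 0 < e / (2 * C0) by rewrite divr_gt0// mulr_gt0.
  (* The bound 1 on the sides is arbitrary: it is the total of mu(d)^(1 + al) that must be small. *)
  have [s [s0 sB sm]] := mass_powR_cover w_weight C_ge1 w_a1 B0 al_gt0 ltr01 e1.
  apply: le_trans (integral_le_sum_cubes mB (@mh _) h0 sB) _.
  apply: (@le_trans _ _ (\sum_(d <- s) (2 * C0 * (mass w d * mass w d `^ al))%:E)%E).
    rewrite big_seq [leRHS]big_seq; apply: lee_sum => d /s0/andP[d0 _].
    exact: negative_part_bound.
  rewrite sumEFin -mulr_sumr lee_fin mulrC -ler_pdivlMr ?mulr_gt0//.
  exact: ltW.
have [+ _] := ae_eq_integral_abs leb mB (@mh _).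
rewrite (eq_integral h); last by move=> x _; rewrite gee0_abs.
move=> /(_ hB0) [N [mN N0 sN]].
apply/eqP; rewrite -measure_le0 -N0; apply: le_lebn => x [/= bx Bx]; apply: sN => /= hx.
apply: bx; have /= := hx Bx; rewrite /h => -[] /eqP; rewrite subr_eq0 => /eqP <-.
exact: normr_ge0.
Qed.

End testing_to_lipschitz.

(** * Pointwise estimates for Lipschitz functions *)

Section lipschitz_pointwise.
Context {R : realType} {n : nat}.
Local Notation V := 'rV[R]_n.+1.
Local Notation T := (Rn R n).
Local Notation leb := (@lebn R n).
Local Notation cubep c := (cube c.1 c.2 : set T).
Local Notation volume := (@volume R n).

(** Subadditivity in the form of the outer measure, because it is applied to a set of exceptional
    points that is not shown to be measurable. *)
Lemma lebn_le_sum (I : eqType) (s : seq I) (F : I -> set T) (A : set T) :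
  (forall x, A x -> exists2 i, i \in s & F i x) ->
  (leb A <= \sum_(i <- s) leb (F i))%E.
Proof.
elim: s A => [|i s ih] A As.
  rewrite big_nil (_ : A = set0); first by rewrite measure0.
  by apply/seteqP; split=> // x /As[].
rewrite big_cons; apply: (@le_trans _ _ (leb (F i `|` (A `&` \bigcup_(j in [set` s]) F j)))%E).
  apply: le_lebn => x Ax; have [j] := As x Ax; rewrite inE => /predU1P[->|js] Fx.
    by left.
  by right; split => //; exists j.
apply: le_trans (outer_measureU2 (@lebesgue_outer R n) _ _) _.
by apply: leeD2l; apply: ih => x [_ [j js Fx]]; exists j.
Qed.

Context (w : T -> R) (w_weight : is_weight w) (C : R) (C_ge1 : 1 <= C)
  (w_a1 : {ae leb, forall x, a1_point C w x}).

Let w_ge0 x : 0 <= w x. Proof. by case: w_weight. Qed.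
Let C_gt0 : 0 < C. Proof. exact: lt_le_trans ltr01 C_ge1. Qed.

Context (b : T -> R) (b_loc : locally_integrable_n b) (al K0 : R)
  (al_gt0 : 0 < al) (K0_ge0 : 0 <= K0).
Context (b_lip : forall c : V * R, 0 < c.2 ->
  (\int[leb]_(x in cubep c) `|b x - cube_mean b (cubep c)|%:E <=
    (K0 * (mass w c * mass w c `^ al))%:E)%E).

Local Notation bm c := (cube_mean b (cubep c)).

Let measurable_dev (k : R) (D : set T) : measurable_fun D (fun x => `|b x - k|%:E).
Proof.
apply: measurable_funTS; apply/measurable_EFinP.
have h : measurable_fun setT (fun x => b x - k).
  exact: measurable_funB b_loc.1 (measurable_cst _).
exact: measurableT_comp h.
Qed.

(** The difference of the means is the mean over the smaller cube of b_Q - b, and the integral of |b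
    - b_Q| grows when taken over the larger cube. *)
Lemma mean_sub_le (c c' : V * R) : 0 < c.2 -> 0 < c'.2 ->
  cubep c' `<=` cubep c ->
  `|bm c - bm c'| <= K0 * (mass w c * mass w c `^ al) / volume c'.2.
Proof.
move=> c0 c'0 c'c; have v0 := volume_gt0 w_weight c'0.
rewrite ler_pdivlMr// -lee_fin; apply: le_trans (b_lip c0).
apply: (@le_trans _ _ (\int[leb]_(x in cubep c') `|b x - bm c|%:E)%E); last first.
  by apply: (ge0_subset_integral _ (measurable_cube _ _) (measurable_cube _ _)
    (@measurable_dev _ _) _ c'c) => x _;
    rewrite lee_fin.
have -> : (`|bm c - bm c'| * volume c'.2)%:E =
    `|\int[leb]_(x in cubep c') (bm c - b x)%:E|%E.
  rewrite integral_sub_cube// abse_EFin (cube_meanE b c'0).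
  rewrite -[X in _ * X](gtr0_norm v0) -normrM; congr (`|_|%:E).
  by field; rewrite gt_eqF.
have mk : measurable_fun (cubep c') (fun x => (bm c - b x)%:E).
  apply: measurable_funTS; apply/measurable_EFinP.
  exact: measurable_funB (measurable_cst _) b_loc.1.
apply: le_trans (le_abse_integral leb (measurable_cube _ _) mk) _.
by under eq_integral do rewrite /= distrC.
Qed.

Section at_point.
Context (x : T) (xa : a1_point C w x).

(** A_1 at [x] trades one factor mu(Q) for C w(x) |Q|, and |Q| / |Q'| is at most r^(n+1). *)
Lemma mean_sub_le_a1 (c c' : V * R) (r : R) : 0 < c.2 -> 0 < c'.2 ->
  cubep c' `<=` cubep c -> cubep c x -> c.2 / c'.2 <= r ->
  `|bm c - bm c'| <= K0 * C * w x * r ^+ n.+1 * mass w c `^ al.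
Proof.
move=> c0 c'0 c'c cx cr; apply: le_trans (mean_sub_le c0 c'0 c'c) _.
have v0 := volume_gt0 w_weight c'0.
rewrite ler_pdivrMr//.
have hr : volume c.2 <= r ^+ n.+1 * volume c'.2.
  rewrite /volume mulrCA ler_pM2l ?(unit_volume_gt0 w_weight)// -exprMn.
  have rc : c.2 <= r * c'.2 by rewrite -ler_pdivrMr.
  apply: lerXn2r rc; rewrite nnegrE ?ltW// mulr_gt0//.
  by apply: lt_le_trans cr; rewrite divr_gt0.
have h : mass w c <= C * w x * (r ^+ n.+1 * volume c'.2).
  by apply: le_trans (xa c0 cx) _; apply: ler_wpM2l => //; rewrite mulr_ge0// ltW.
have := ler_wpM2r (powR_ge0 (mass w c) al) h.
move=> /(ler_wpM2l K0_ge0) /le_trans; apply.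
by rewrite le_eqVlt; apply/orP; left; apply/eqP; ring.
Qed.

(** The cube of side 2 l centred at [x], which contains every cube through [x] of side at most l. *)
Let around (l : R) : V * R := (x - const_mx l : V, l *+ 2).

Let around_gt0 (l : R) : 0 < l -> 0 < (around l).2.
Proof. by move=> l0; rewrite pmulrn_lgt0. Qed.

Let sub_around (c : V * R) (l : R) : cubep c x -> c.2 <= l ->
  cubep c `<=` cubep (around l).
Proof.
move=> cx cl y cy i; have := cx i; have := cy i; rewrite /= !mxE.
by move=> /andP[? ?] /andP[? ?]; lra.
Qed.

Let mem_around (l : R) : 0 < l -> cubep (around l) x.
Proof. by move=> l0 i; rewrite /= !mxE; lra. Qed.

Let th := a1_ratio C `^ al.

Let th_lt1 : th < 1.
Proof.
have : a1_ratio C `^ al < 1 `^ al.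
  apply: gt0_ltr_powR => //; rewrite ?nnegrE ?a1_ratio_lt1//.
  exact: ltW (a1_ratio_gt0 C_ge1).
by rewrite powR1.
Qed.

(** The sum of the geometric series with first term K0 C 4^(n+1) and ratio [th], the power al of the
    reverse-doubling ratio; 4 bounds the ratio of sides in one comparison of means. *)
Definition lip_factor : R := K0 * C * 4 ^+ n.+1 / (1 - th).

Let A := lip_factor * w x.

Lemma lip_factor_ge0 : 0 <= lip_factor.
Proof.
rewrite divr_ge0 ?subr_ge0 ?(ltW th_lt1)// mulr_ge0 ?exprn_ge0// mulr_ge0//.
exact: ltW.
Qed.

(** The fixed-point equation on which the telescoping induction closes: one step plus the
    geometrically reduced remainder. *)
Let AE : A = K0 * C * w x * 4 ^+ n.+1 + A * th.
Proof.
have : 1 - th != 0 by rewrite gt_eqF// subr_gt0.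
by rewrite /A /lip_factor => h; field.
Qed.

Let A_ge0 : 0 <= A. Proof. by rewrite mulr_ge0 ?lip_factor_ge0. Qed.

Let le_A (r : R) (c : V * R) : 0 <= r <= 4 ->
  K0 * C * w x * r ^+ n.+1 * mass w c `^ al <= A * mass w c `^ al.
Proof.
move=> /andP[r0 r4]; apply: ler_wpM2r; first exact: powR_ge0.
rewrite AE -[leLHS]addr0; apply: lerD; last by rewrite mulr_ge0 ?powR_ge0.
apply: ler_wpM2l; first by rewrite !mulr_ge0// ltW.
by apply: lerXn2r => //; rewrite nnegrE.
Qed.

(* By reverse doubling, the differences of means over the cubes around [x] of
   sides [2 l, l, l / 2, ...] are dominated by a geometric series. *)
Lemma mean_telescope (j : nat) (c' : V * R) (l : R) : 0 < c'.2 -> cubep c' x ->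
  c'.2 <= l <= 2 ^+ j * c'.2 ->
  `|bm (around l) - bm c'| <= A * mass w (around l) `^ al.
Proof.
elim: j l => [|j ih] l c'0 c'x /andP[l1 l2]; have l0 := lt_le_trans c'0 l1.
  apply: le_trans (mean_sub_le_a1 (r := 4) (around_gt0 l0) c'0
    (sub_around c'x l1) (mem_around l0) _) _.
    by rewrite /= ler_pdivrMr//; rewrite expr0 mul1r in l2; lra.
  by apply: le_A; rewrite lexx andbT.
(* The sides 2 l and [c'.2] then have ratio at most 4, so a single comparison is enough. *)
have [le|lt] := leP l (c'.2 * 2).
  apply: le_trans (mean_sub_le_a1 (r := 4) (around_gt0 l0) c'0
    (sub_around c'x l1) (mem_around l0) _) _.
    by rewrite /= ler_pdivrMr//; lra.
  by apply: le_A; rewrite lexx andbT.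
have h0 : 0 < l / 2 by rewrite divr_gt0.
have hh : c'.2 <= l / 2 <= 2 ^+ j * c'.2.
  by apply/andP; split; [lra|move: l2; rewrite exprS; lra].
have sub : cubep (around (l / 2)) `<=` cubep (around l).
  by move=> y yl i; have := yl i; rewrite /= !mxE => /andP[? ?]; lra.
have step : `|bm (around l) - bm (around (l / 2))| <=
    K0 * C * w x * 4 ^+ n.+1 * mass w (around l) `^ al.
  apply: mean_sub_le_a1 => //; [exact: around_gt0|exact: around_gt0|exact: mem_around|].
  by rewrite /= ler_pdivrMr ?pmulrn_lgt0//; lra.
have := ih (l / 2) c'0 c'x hh => {}ih.
have ih2 : `|bm (around (l / 2)) - bm c'| <= A * th * mass w (around l) `^ al.
  apply: le_trans ih _; rewrite -mulrA; apply: ler_wpM2l => //.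
  rewrite /th -powRM ?mass_ge0 ?(ltW (a1_ratio_gt0 C_ge1))//.
  apply: ge0_ler_powR; rewrite ?nnegrE ?mass_ge0 ?(ltW al_gt0)//.
    by rewrite mulr_ge0 ?mass_ge0// ltW// a1_ratio_gt0.
  apply: (a1_reverse_doubling w_weight C_ge1 w_a1) sub; first exact: around_gt0.
  by rewrite /=; lra.
rewrite -(subrKA (bm (around (l / 2)))); apply: le_trans (ler_normD _ _) _.
apply: le_trans (lerD step ih2) _; rewrite -mulrDl -AE; exact: lexx.
Qed.

(** Two comparisons with the cube of side 2 [c.2] around [x] give the factor 2; by doubling its mass
    is at most C 2^(n+1) times that of [c], which enters with the power al. *)
Definition lip_constant : R := 2 * lip_factor * (C * 2 ^+ n.+1) `^ al.

(** The two cubes may fail to be nested, so both are compared with a cube centred at [x] that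
    contains them. *)
Lemma mean_sub_small (c c' : V * R) : 0 < c'.2 -> c'.2 <= c.2 ->
  cubep c x -> cubep c' x ->
  `|bm c - bm c'| <= lip_constant * w x * mass w c `^ al.
Proof.
move=> c'0 c'c cx c'x; have c0 := lt_le_trans c'0 c'c.
have cP := sub_around cx (lexx _).
have h1 : `|bm (around c.2) - bm c| <= A * mass w (around c.2) `^ al.
  apply: le_trans (mean_sub_le_a1 (r := 4) (around_gt0 c0) c0 cP (mem_around c0) _) _.
    by rewrite /= ler_pdivrMr//; lra.
  by apply: le_A; rewrite lexx andbT.
have h2 : `|bm (around c.2) - bm c'| <= A * mass w (around c.2) `^ al.
  pose j := Num.bound `|c.2 / c'.2|.
  apply: (mean_telescope (j := j)) => //; rewrite c'c/= -ler_pdivrMr//.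
  apply: le_trans (ler_norm _) _.
  apply: le_trans (ltW (archi_boundP (normr_ge0 _))) _.
  by rewrite -natrX ler_nat ltnW// ltn_expl.
have m2 : mass w (around c.2) `^ al <= (C * 2 ^+ n.+1) `^ al * mass w c `^ al.
  have C2 : 0 <= C * 2 ^+ n.+1 by rewrite mulr_ge0 ?exprn_ge0// ltW.
  rewrite -powRM ?mass_ge0//.
  apply: ge0_ler_powR; [exact: ltW|by rewrite nnegrE mass_ge0|
    by rewrite nnegrE mulr_ge0 ?mass_ge0|].
  have r2 : (around c.2).2 / c.2 = 2.
    by rewrite /= mulr2n; field; rewrite gt_eqF.
  by have := a1_doubling w_weight C_ge1 w_a1 c0 (around_gt0 c0) cP; rewrite r2.
rewrite -(subrKA (bm (around c.2))); apply: le_trans (ler_normD _ _) _.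
rewrite distrC; apply: le_trans (lerD h1 h2) _.
have := ler_wpM2l A_ge0 m2 => h.
apply: le_trans (lerD h h) _.
by rewrite /A /lip_constant le_eqVlt; apply/orP; left; apply/eqP; ring.
Qed.

End at_point.
Let far (e : R) (c : V * R) : set T := cubep c `&` [set x | e <= `|b x - bm c|].

Let far_le (e : R) (c : V * R) : 0 < e -> 0 < c.2 ->
  (leb (far e c) <= (e^-1 * K0 * (mass w c * mass w c `^ al))%:E)%E.
Proof.
move=> e0 c0; have mc := measurable_cube c.1 c.2.
rewrite -mulrA EFinM lee_pdivlMl//.
have mg : measurable_fun (cubep c) (fun x => (b x - bm c)%:E).
  apply: measurable_funTS; apply/measurable_EFinP.
  exact: measurable_funB b_loc.1 (measurable_cst _).
have := le_integral_abse leb mc mg e0.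
have -> : cubep c `&` [set x | (e%:E <= `|(b x - bm c)%:E|)%E] = far e c.
  by apply/seteqP; split=> x [? ?]; split.
by move=> h; apply: le_trans h _; exact: b_lip.
Qed.

(* The cubes of a cheap cover carry little oscillation in total. *)
Lemma ae_exists_small_cube : {ae leb, forall x, forall e d : R, 0 < e -> 0 < d ->
  exists c : V * R, [/\ 0 < c.2 < d, cubep c x & `|b x - bm c| <= e]}.
Proof.
(* Both tolerances are replaced by 1 / (m + 1), which leaves a countable union. A point of [bad m]
   lies in the [far] set of every sufficiently small cube through it. *)
pose bad m : set T := [set x | forall c : V * R, 0 < c.2 < m.+1%:R^-1 ->
  cubep c x -> m.+1%:R^-1 <= `|b x - bm c|].
apply: (@negligibleS _ _ _ _ (\bigcup_m bad m)).
  move=> x /= /existsNP[e] /existsNP[d] /not_implyP[e0] /not_implyP[d0] nex.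
  pose m := Num.bound (e^-1 + d^-1).
  have mb : e^-1 + d^-1 < m.+1%:R.
    apply: lt_trans (archi_boundP _) _; last by rewrite ltr_nat.
    by apply: addr_ge0; rewrite invr_ge0 ltW.
  have eV0 : 0 < e^-1 by rewrite invr_gt0.
  have dV0 : 0 < d^-1 by rewrite invr_gt0.
  exists m => // c /andP[c0 cm] cx; rewrite leNgt; apply/negP => be; apply: nex.
  exists c; split => //.
    rewrite c0/= (lt_trans cm)// invf_plt ?posrE//; lra.
  rewrite ltW// (lt_trans be)// invf_plt ?posrE//; lra.
apply: negligible_bigcup => m; apply: negligible_centered_cube => k.
pose e : R := m.+1%:R^-1; have e0 : 0 < e by rewrite invr_gt0.
pose B : V * R := (const_mx (- k.+1%:R), k.+1%:R *+ 2).
have B0 : 0 < B.2 by rewrite pmulrn_lgt0.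
apply/eqP; rewrite -measure_le0; apply/lee_addgt0Pr => eta eta0; rewrite add0e.
(* The + 1 keeps the denominator positive when K0 = 0. *)
have h0 : 0 < eta / (e^-1 * K0 + 1).
  by rewrite divr_gt0// ltr_wpDl// mulr_ge0// invr_ge0 ltW.
have [s [s0 sB sm]] := mass_powR_cover w_weight C_ge1 w_a1 B0 al_gt0 e0 h0.
apply: (@le_trans _ _ (\sum_(c <- s) leb (far e c))%E).
  apply: lebn_le_sum => x [badx Bx]; have [c cs cx] := sB x Bx.
  by exists c => //; split => //; apply: badx => //; exact: s0.
apply: (@le_trans _ _ (\sum_(c <- s) (e^-1 * K0 * (mass w c * mass w c `^ al))%:E)%E).
  by rewrite big_seq [leRHS]big_seq; apply: lee_sum => c /s0/andP[? _]; exact: far_le.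
rewrite sumEFin -mulr_sumr lee_fin.
have eK : 0 <= e^-1 * K0 by rewrite mulr_ge0// invr_ge0 ltW.
move: sm; rewrite ltr_pdivlMr ?ltr_wpDl// => /ltW; apply: le_trans.
rewrite mulrC; apply: ler_wpM2l; last by rewrite lerDl.
by apply: sumr_ge0 => c _; rewrite mulr_ge0 ?mass_ge0 ?powR_ge0.
Qed.

(** The mean over a small cube is within e of b(x), its distance to the given mean is bounded
    independently of the small cube, and e is arbitrary. *)
Lemma ae_lip_pointwise : {ae leb, forall x, forall c : V * R, 0 < c.2 ->
  cubep c x -> `|b x - bm c| <= lip_constant * w x * mass w c `^ al}.
Proof.
apply: filterS2 w_a1 ae_exists_small_cube => x xa small c c0 cx.
apply/ler_addgt0Pl => e e0.
have [c' [/andP[c'0 c'c] c'x be]] := small e c.2 e0 c0.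
have := mean_sub_small xa c'0 (ltW c'c) cx c'x; rewrite distrC => bb.
by rewrite -(subrKA (bm c')); apply: le_trans (ler_normD _ _) _; exact: lerD.
Qed.

End lipschitz_pointwise.

(** Read i as the integral of |f| mu over Q, m as mu(Q), v as M_mu f (x), and L as the constant of
    Hölder's inequality. The left side factors exactly as (i / m)^(1 - p al) times (i m^(1/p -
    1))^(p al), and the last two hypotheses bound one factor each. *)
Lemma hedberg_interpolation {R : realType} (i m v L p al : R) :
  0 <= i -> 0 < m -> 0 < p -> 0 < al -> p * al < 1 -> i / m <= v ->
  i <= L * m `^ (1 - p^-1) ->
  m `^ (al - 1) * i <= v `^ (1 - p * al) * L `^ (p * al).
Proof.
move=> i0 m0 p0 al0 pal iv iL.
have [->|in0] := eqVneq i 0; first by rewrite mulr0 mulr_ge0 ?powR_ge0.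
have {in0} i_gt0 : 0 < i by rewrite lt_neqAle eq_sym in0.
have mn0 : (m == 0) = false by rewrite gt_eqF.
have in0 : (i == 0) = false by rewrite gt_eqF.
have palp : 0 < p * al by rewrite mulr_gt0.
have L0 : i * m `^ (p^-1 - 1) <= L.
  rewrite -(opprB 1) powRN ler_pdivrMr ?powR_gt0//.
have -> : m `^ (al - 1) * i =
    (i / m) `^ (1 - p * al) * (i * m `^ (p^-1 - 1)) `^ (p * al).
  rewrite !powRM ?powR_ge0 ?invr_ge0 ?(ltW m0)//.
  rewrite -(powR_inv1 (ltW m0)) -!powRrM.
  rewrite mulrACA -!powRD ?mn0 ?in0 ?implybT//.
  rewrite subrK powRr1// mulrC; congr (_ * m `^ _).
  by field; rewrite gt_eqF.
have im0 : 0 <= i / m by rewrite divr_ge0// ltW.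
have imp0 : 0 <= i * m `^ (p^-1 - 1) by rewrite mulr_ge0 ?powR_ge0.
apply: ler_pM; rewrite ?powR_ge0//.
  apply: (ge0_ler_powR _ _ _ iv); rewrite ?nnegrE ?subr_ge0 ?(ltW pal)//.
  exact: le_trans im0 iv.
apply: (ge0_ler_powR _ _ _ L0); rewrite ?nnegrE ?(ltW palp)//.
exact: le_trans imp0 L0.
Qed.

(** The inequality is repaired on the null set by adding to [g] the function equal to +oo there and
    0 elsewhere, whose integral is zero. *)
Lemma ae_le_integral_nonmeasurable d (T : measurableType d) (R : realType)
    (nu : {measure set T -> \bar R}) (f g : T -> \bar R) :
  (forall x, 0 <= f x)%E -> (forall x, 0 <= g x)%E -> measurable_fun setT g ->
  {ae nu, forall x, f x <= g x}%E ->
  (\int[nu]_x f x <= \int[nu]_x g x)%E.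
Proof.
move=> f0 g0 mg [N [mN N0 sN]].
pose h x : \bar R := (+oo * (\1_N x)%:E)%E.
have mh : measurable_fun setT h.
  apply: emeasurable_funM (measurable_cst _) _.
  by apply/measurable_EFinP; exact: measurable_indic.
have h0 x : (0 <= h x)%E by rewrite mule_ge0// lee_fin indicE ler0n.
apply: (@le_trans _ _ (\int[nu]_x (g x + h x))%E).
  apply: le_integral_nonmeasurable => x _; first exact: f0.
  have [xN|xN] := boolP (x \in N).
    by rewrite /h indicE xN mule1 addey ?leey// -ltNye (lt_le_trans _ (g0 _)).
  rewrite (le_trans _ (leeDl _ (h0 x)))//.
  by apply: contraNT xN => fg; rewrite inE; apply: sN => /=; apply/negP.
rewrite (ge0_integralD _ measurableT (fun x _ => g0 x) mg (fun x _ => h0 x) mh).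
rewrite (_ : \int[nu]_x h x = 0)%E ?adde0//.
rewrite (eq_integral ((cst +oo%E) \_ N)); last first.
  by move=> x _; rewrite /h patchE indicE; case: (_ \in _); rewrite ?mule1 ?mule0.
by rewrite -integral_mkcond integral_cst// N0 mule0.
Qed.

(** * Weighted Hölder inequality, and plain averages against weighted ones *)

Section lipschitz_to_bounded.
Context {R : realType} {n : nat}.
Local Notation V := 'rV[R]_n.+1.
Local Notation T := (Rn R n).
Local Notation leb := (@lebn R n).
Local Notation cubep c := (cube c.1 c.2 : set T).
Local Notation volume := (@volume R n).

Context (w : T -> R) (w_weight : is_weight w) (C : R) (C_ge1 : 1 <= C)
  (w_a1 : {ae leb, forall x, a1_point C w x}).

Let w_ge0 x : 0 <= w x. Proof. by case: w_weight. Qed.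
Let C_gt0 : 0 < C. Proof. exact: lt_le_trans ltr01 C_ge1. Qed.

Lemma weighted_integral_holder (f : T -> R) (c : V * R) (p F : R) :
  measurable_fun setT f -> 1 < p -> 0 < F ->
  (\int[leb]_x (`|f x| `^ p * w x)%:E <= F%:E)%E -> 0 < c.2 ->
  (weighted_integral w f (cubep c) <=
    (2 * F `^ p^-1 * mass w c `^ (1 - p^-1))%:E)%E.
Proof.
move=> mf p1 F0 hF c0; have m0 := mass_gt0 w_weight C_ge1 w_a1 c0.
have p0 : 0 < p := lt_trans ltr01 p1.
(* t = (F / m)^(1/p) balances the two terms of [le_add_powR], each becoming F^(1/p) m^(1 - 1/p);
   hence the constant 2. *)
set m := mass w c in m0 *; pose t := F `^ p^-1 * m `^ (- p^-1).
have t0 : 0 < t by rewrite mulr_gt0 ?powR_gt0.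
have mQ := measurable_cube c.1 c.2.
have mw D : measurable_fun D w by apply: measurable_funTS; case: w_weight => -[].
have mtw : measurable_fun (cubep c) (fun x => t%:E * (w x)%:E)%E.
  exact: emeasurable_funM (measurable_cst _) (@measurable_weight_in _ _ _ w_weight _).
pose g x : R := `|f x| `^ p * w x.
have mg : measurable_fun setT (fun x => (g x)%:E).
  apply/measurable_EFinP; apply: measurable_funM (@mw _).
  have mnf : measurable_fun setT (fun x => `|f x|) by exact: measurableT_comp mf.
  exact: measurableT_comp (measurable_powR p) mnf.
have mgQ : measurable_fun (cubep c) (fun x => (g x)%:E) by exact: measurable_funTS mg.
have g0 x : (0 <= (g x)%:E)%E by rewrite lee_fin mulr_ge0 ?powR_ge0.
have mtg : measurable_fun (cubep c) (fun x => (t `^ (1 - p))%:E * (g x)%:E)%E.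
  exact: emeasurable_funM (measurable_cst _) mgQ.
have w0 x : (0 <= (w x)%:E)%E by rewrite lee_fin.
have te0 : (0 <= t%:E)%E by rewrite lee_fin ltW.
have tp0 : (0 <= (t `^ (1 - p))%:E)%E by rewrite lee_fin powR_ge0.
have tw0 x : (0 <= t%:E * (w x)%:E)%E by rewrite mule_ge0.
have tg0 x : (0 <= (t `^ (1 - p))%:E * (g x)%:E)%E by rewrite mule_ge0.
apply: (@le_trans _ _ (\int[leb]_(x in cubep c)
   (t%:E * (w x)%:E + (t `^ (1 - p))%:E * (g x)%:E))%E).
  apply: le_integral_nonmeasurable => x _; first exact: weighted_fun_ge0.
  rewrite -!EFinM -EFinD lee_fin /g mulrA -mulrDl; apply: ler_wpM2r => //.
  have := le_add_powR (ltW p1) (normr_ge0 (f x)) t0 ltr01.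
  by rewrite mulr1 powR1 mulr1.
rewrite (ge0_integralD _ mQ (fun x _ => tw0 x) mtw (fun x _ => tg0 x) mtg).
rewrite (ge0_integralZl _ mQ mgQ (fun x _ => g0 x) tp0).
rewrite (ge0_integralZl _ mQ (@measurable_weight_in _ _ _ w_weight _) (fun x _ => w0 x) te0).
have gF : (\int[leb]_(x in cubep c) (g x)%:E <= F%:E)%E.
  apply: le_trans hF.
  by apply: (ge0_subset_integral _ mQ measurableT mg (fun x _ => g0 x) (@subsetT _ _)).
rewrite -/(weight_measure w _) weight_measure_cube// -[mass _ _]/m.
apply: le_trans (leeD2l _ (lee_wpmul2l tp0 gF)) _.
rewrite -!EFinM -EFinD lee_fin.
have FV : (F == 0) = false by rewrite gt_eqF.
have mV : (m == 0) = false by rewrite gt_eqF.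
have -> : t * m = F `^ p^-1 * m `^ (1 - p^-1).
  rewrite /t -mulrA -[X in _ * X = _](_ : m `^ (- p^-1) * m `^ 1 = _).
    by rewrite -powRD ?mV ?implybT// addrC.
  by rewrite powRr1// ltW.
have -> : t `^ (1 - p) * F = F `^ p^-1 * m `^ (1 - p^-1).
  rewrite /t powRM ?powR_ge0// -!powRrM mulrAC -[X in _ * X * _ = _](powRr1 (ltW F0)).
  rewrite -powRD ?FV ?implybT//; congr (F `^ _ * m `^ _); field; rewrite gt_eqF//.
by rewrite le_eqVlt; apply/orP; left; apply/eqP; ring.
Qed.

(** At almost every point y of the cube, A_1 gives 1 <= C w(y) |Q| / mu(Q). *)
Lemma integral_le_weighted (f : T -> R) (c : V * R) :
  measurable_fun setT f -> 0 < c.2 ->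
  (\int[leb]_(x in cubep c) `|f x|%:E <=
    (C * volume c.2 / mass w c)%:E * weighted_integral w f (cubep c))%E.
Proof.
move=> mf c0; have m0 := mass_gt0 w_weight C_ge1 w_a1 c0.
have v0 := volume_gt0 w_weight c0; have mQ := measurable_cube c.1 c.2.
have k0 : 0 <= C * volume c.2 / mass w c.
  by rewrite divr_ge0 ?(ltW m0)// mulr_ge0 ?(ltW v0)// ltW.
have mfw := measurable_funTS (D := cubep c) (measurable_weighted_fun w_weight mf).
have ke0 : (0 <= (C * volume c.2 / mass w c)%:E)%E by rewrite lee_fin.
rewrite /weighted_integral.
rewrite -(ge0_integralZl _ mQ mfw (fun x _ => weighted_fun_ge0 w_weight f x) ke0).
have mnf : measurable_fun (cubep c) (fun x => `|f x|%:E).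
  apply: measurable_funTS; apply/measurable_EFinP.
  exact: measurableT_comp mf.
apply: (ae_ge0_le_integral mQ _ mnf _ (emeasurable_funM (measurable_cst _) mfw)).
- by move=> x _; rewrite lee_fin.
- by move=> x _; rewrite mule_ge0// lee_fin mulr_ge0.
- apply: filterS w_a1 => x xa cx; rewrite -EFinM lee_fin.
  have := xa c c0 cx => /(ler_wpM2l (normr_ge0 (f x))) h.
  rewrite [leRHS](_ : _ = `|f x| * (C * w x * volume c.2) / mass w c); last by ring.
  by rewrite ler_pdivlMr.
Qed.

End lipschitz_to_bounded.

(** * The commutator *)

Section commutator_bound.
Context {R : realType} {n : nat}.
Local Notation V := 'rV[R]_n.+1.
Local Notation T := (Rn R n).
Local Notation leb := (@lebn R n).
Local Notation cubep c := (cube c.1 c.2 : set T).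
Local Notation volume := (@volume R n).

Context (w : T -> R) (w_weight : is_weight w) (C : R) (C_ge1 : 1 <= C)
  (w_a1 : {ae leb, forall x, a1_point C w x}).

Let w_ge0 x : 0 <= w x. Proof. by case: w_weight. Qed.
Let C_gt0 : 0 < C. Proof. exact: lt_le_trans ltr01 C_ge1. Qed.

Context (b : T -> R) (b_loc : locally_integrable_n b) (al D : R)
  (D_ge0 : 0 <= D).

Definition lip_point (x : T) := forall c : V * R, 0 < c.2 -> cubep c x ->
  `|b x - cube_mean b (cubep c)| <= D * w x * mass w c `^ al.

Context (b_lip : {ae leb, forall x, lip_point x}).
Context (f : T -> R) (mf : measurable_fun setT f).

Let mnf (B : set T) : measurable_fun B (fun y => `|f y|%:E).
Proof.
apply: measurable_funTS; apply/measurable_EFinP; exact: measurableT_comp mf.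
Qed.

Let mbf (B : set T) : measurable_fun B (fun y => `|b y * f y|%:E).
Proof.
apply: measurable_funTS; apply/measurable_EFinP.
exact: measurableT_comp (measurable_funM b_loc.1 mf).
Qed.

Let mdf (k : R) (B : set T) : measurable_fun B (fun y => (`|k - b y| * `|f y|)%:E).
Proof.
apply: measurable_funTS; apply/measurable_EFinP; apply: measurable_funM.
  have h : measurable_fun setT (fun y => k - b y).
    exact: measurable_funB (measurable_cst _) b_loc.1.
  exact: measurableT_comp h.
exact: measurableT_comp mf.
Qed.

Let mfw (B : set T) := measurable_funTS (D := B) (measurable_weighted_fun w_weight mf).
Let fw0 x := weighted_fun_ge0 w_weight f x.
Let absf0 x : (0 <= `|f x|%:E)%E. Proof. by rewrite lee_fin. Qed.

Section at_point.
Context (x : T) (xa : a1_point C w x) (xl : lip_point x).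

(** Passing through the mean over the cube, |b x - b y| is at most D mu(Q)^al (w x + w y) for almost
    every y in it. *)
Lemma integral_dev_le (c : V * R) : 0 < c.2 -> cubep c x ->
  (\int[leb]_(y in cubep c) (`|b x - b y| * `|f y|)%:E <=
    (D * mass w c `^ al)%:E * ((w x)%:E * \int[leb]_(y in cubep c) `|f y|%:E +
      weighted_integral w f (cubep c)))%E.
Proof.
move=> c0 cx; have mQ := measurable_cube c.1 c.2.
have k0 : (0 <= (D * mass w c `^ al)%:E)%E by rewrite lee_fin mulr_ge0 ?powR_ge0.
have wx0 : (0 <= (w x)%:E)%E by rewrite lee_fin.
have mwf : measurable_fun (cubep c) (fun y => (w x)%:E * `|f y|%:E)%E.
  exact: emeasurable_funM (measurable_cst _) (@mnf _).
have wf0 y : (0 <= (w x)%:E * `|f y|%:E)%E by rewrite mule_ge0.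
have ms : measurable_fun (cubep c)
    (fun y => (w x)%:E * `|f y|%:E + (`|f y| * w y)%:E)%E.
  exact: emeasurable_funD mwf (@mfw _).
have s0 y : (0 <= (w x)%:E * `|f y|%:E + (`|f y| * w y)%:E)%E by rewrite adde_ge0.
rewrite /weighted_integral -(ge0_integralZl _ mQ (@mnf _) (fun y _ => absf0 y) wx0).
rewrite -(ge0_integralD _ mQ (fun y _ => wf0 y) mwf (fun y _ => fw0 y) (@mfw _)).
rewrite -(ge0_integralZl _ mQ ms (fun y _ => s0 y) k0).
apply: (ae_ge0_le_integral mQ _ (@mdf _ _) _ (emeasurable_funM (measurable_cst _) ms)).
- by move=> y _; rewrite lee_fin mulr_ge0.
- by move=> y _; rewrite mule_ge0.
- apply: filterS b_lip => y yl cy; rewrite /= -EFinM lee_fin.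
  have h1 := xl c0 cx; have h2 := yl c c0 cy; rewrite distrC in h2.
  have h : `|b x - b y| <= D * mass w c `^ al * (w x + w y).
    rewrite -(subrKA (cube_mean b (cubep c))); apply: le_trans (ler_normD _ _) _.
    apply: le_trans (lerD h1 h2) _.
    by rewrite le_eqVlt; apply/orP; left; apply/eqP; ring.
  apply: le_trans (ler_wpM2r (normr_ge0 (f y)) h) _.
  by rewrite le_eqVlt; apply/orP; left; apply/eqP; ring.
Qed.

Lemma mean_dev_le (c : V * R) : 0 < c.2 -> cubep c x ->
  ((volume c.2)^-1%:E * \int[leb]_(y in cubep c) (`|b x - b y| * `|f y|)%:E <=
    (2 * D * C * w x * mass w c `^ (al - 1))%:E *
      weighted_integral w f (cubep c))%E.
Proof.
move=> c0 cx; have v0 := volume_gt0 w_weight c0.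
have m0 := mass_gt0 w_weight C_ge1 w_a1 c0.
set I := weighted_integral w f (cubep c).
have I0 : (0 <= I)%E by exact: integral_ge0.
apply: (@le_trans _ _ ((volume c.2)^-1%:E * ((D * mass w c `^ al)%:E *
    (((w x)%:E * ((C * volume c.2 / mass w c)%:E * I)) + I)))%E).
  apply: lee_wpmul2l; first by rewrite lee_fin invr_ge0 ltW.
  apply: le_trans (integral_dev_le c0 cx) _.
  apply: lee_wpmul2l; first by rewrite lee_fin mulr_ge0 ?powR_ge0.
  apply: leeD2r; apply: lee_wpmul2l; first by rewrite lee_fin.
  exact: integral_le_weighted.
rewrite -[X in (_ * (_ * (_ + X)))%E]mul1e muleA muleA -EFinM -EFinM.
have kw0 : (0 <= (w x * (C * volume c.2 / mass w c))%:E)%E.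
  by rewrite lee_fin mulr_ge0// divr_ge0 ?(ltW m0)// mulr_ge0 ?(ltW v0)// ltW.
rewrite -ge0_muleDl//.
rewrite -EFinD muleA -EFinM; apply: lee_wpmul2r => //; rewrite lee_fin.
rewrite powRD ?(gt_eqF m0) ?implybT// powR_inv1 ?(ltW m0)//.
(* A_1 at [x], used to give the term without [w x] the same form as the other one. *)
have h : 1 <= C * w x * volume c.2 / mass w c.
  by rewrite ler_pdivlMr// mul1r; exact: xa.
apply: (@le_trans _ _ ((volume c.2)^-1 * (D * mass w c `^ al) *
   (C * w x * volume c.2 / mass w c + C * w x * volume c.2 / mass w c))).
  apply: ler_wpM2l; first by rewrite mulr_ge0 ?invr_ge0 ?(ltW v0)// mulr_ge0 ?powR_ge0.
  apply: lerD => //; rewrite le_eqVlt; apply/orP; left; apply/eqP; ring.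
by rewrite le_eqVlt; apply/orP; left; apply/eqP; field; rewrite !gt_eqF.
Qed.

Context (bx0 : 0 <= b x).

Let vinv0 (c : V * R) : 0 < c.2 -> (0 <= (volume c.2)^-1%:E)%E.
Proof. by move=> c0; rewrite lee_fin invr_ge0 ltW// (volume_gt0 w_weight). Qed.

(** This bound and [mul_abs_mean_le] are the averages of the two triangle inequalities relating |b
    y| to b x = |b x| with error |b x - b y|. *)
Lemma abs_mean_mul_le (c : V * R) : 0 < c.2 ->
  (cube_abs_mean (fun y => b y * f y)%R (cubep c) <=
    (b x)%:E * cube_abs_mean f (cubep c) +
    (volume c.2)^-1%:E * \int[leb]_(y in cubep c) (`|b x - b y| * `|f y|)%:E)%E.
Proof.
move=> c0; have mQ := measurable_cube c.1 c.2.
rewrite !(cube_abs_meanE w_weight)// muleCA -ge0_muleDr ?mule_ge0 ?integral_ge0//.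
apply: lee_wpmul2l; first exact: vinv0.
have b0 : (0 <= (b x)%:E)%E by rewrite lee_fin.
have d0 y : (0 <= (`|b x - b y| * `|f y|)%:E)%E by rewrite lee_fin mulr_ge0.
have bf0 y : (0 <= (b x)%:E * `|f y|%:E)%E by rewrite mule_ge0.
have mb : measurable_fun (cubep c) (fun y => (b x)%:E * `|f y|%:E)%E.
  exact: emeasurable_funM (measurable_cst _) (@mnf _).
rewrite -(ge0_integralZl _ mQ (@mnf _) (fun y _ => absf0 y) b0).
rewrite -(ge0_integralD _ mQ (fun y _ => bf0 y) mb (fun y _ => d0 y) (@mdf _ _)).
apply: le_integral_nonmeasurable => y _; first by rewrite lee_fin.
rewrite -EFinM -EFinD lee_fin -mulrDl normrM; apply: ler_wpM2r => //.
rewrite -[X in `|X| <= _](subKr (b x)).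
by apply: le_trans (ler_normB _ _) _; rewrite (ger0_norm bx0).
Qed.

Lemma mul_abs_mean_le (c : V * R) : 0 < c.2 ->
  ((b x)%:E * cube_abs_mean f (cubep c) <=
    cube_abs_mean (fun y => b y * f y)%R (cubep c) +
    (volume c.2)^-1%:E * \int[leb]_(y in cubep c) (`|b x - b y| * `|f y|)%:E)%E.
Proof.
move=> c0; have mQ := measurable_cube c.1 c.2.
have b0 : (0 <= (b x)%:E)%E by rewrite lee_fin.
have d0 y : (0 <= (`|b x - b y| * `|f y|)%:E)%E by rewrite lee_fin mulr_ge0.
rewrite !(cube_abs_meanE w_weight)// muleCA -ge0_muleDr ?integral_ge0//.
apply: lee_wpmul2l; first exact: vinv0.
have bf0 y : (0 <= `|b y * f y|%:E)%E by rewrite lee_fin.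
rewrite -(ge0_integralZl _ mQ (@mnf _) (fun y _ => absf0 y) b0).
rewrite -(ge0_integralD _ mQ (fun y _ => bf0 y) (@mbf _) (fun y _ => d0 y) (@mdf _ _)).
apply: le_integral_nonmeasurable => y _; first by rewrite mule_ge0.
rewrite -EFinM -EFinD lee_fin normrM -mulrDl; apply: ler_wpM2r => //.
rewrite -{1}(ger0_norm bx0) addrC -[X in `|X| <= _](subrK (b y)).
exact: ler_normD.
Qed.

(** Averages over the same cubes that differ by at most E have suprema that differ by at most E.
    Finiteness of [maximal f x] makes the other supremum finite and the difference defined. *)
Lemma commutator_le (E : R) :
  0 <= E -> maximal f x \is a fin_num ->
  (forall c : V * R, (0 < c.2)%R -> cubep c x -> (volume c.2)^-1%:E *
     \int[leb]_(y in cubep c) (`|b x - b y| * `|f y|)%:E <= E%:E)%E ->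
  commutator_maximal b f x \is a fin_num /\
  (`|commutator_maximal b f x| <= E%:E)%E.
Proof.
move=> E0 fin dev; rewrite /commutator_maximal.
set W := maximal (fun y => b y * f y)%R x.
set U := maximal f x in fin *.
have x1 : [set Q : set T | is_cube Q /\ Q x] (cube x 1).
  by split; [exists x, 1|exact: cube_nonempty].
have b0 : (0 <= (b x)%:E)%E by rewrite lee_fin.
have W0 : (0 <= W)%E.
  apply: le_trans (ereal_sup_ubound (imageP _ x1)).
  exact: (@cube_abs_mean_ge0 _ _ _ w_weight _ (x : V, 1)).
have W_le : (W <= (b x)%:E * U + E%:E)%E.
  apply: ge_ereal_sup => _ [_ [/is_cubeP[c c0 ->] cx] <-].
  apply: le_trans (abs_mean_mul_le c0) _; apply: leeD; last exact: dev.
  apply: (lee_wpmul2l b0); apply: ereal_sup_ubound; exists (cubep c); last by [].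
  by split => //; exact: is_cube_cube.
have U_le : ((b x)%:E * U <= W + E%:E)%E.
  (* The factor [b x] is moved past the supremum by division, so b x = 0 is treated apart. *)
  have [b_eq|b_neq] := eqVneq (b x) 0; first by rewrite b_eq mul0e adde_ge0.
  have b_gt0 : 0 < b x by rewrite lt_neqAle eq_sym b_neq.
  rewrite -lee_pdivlMl//.
  apply: ge_ereal_sup => _ [_ [/is_cubeP[c c0 ->] cx] <-].
  rewrite lee_pdivlMl//; apply: le_trans (mul_abs_mean_le c0) _.
  apply: leeD; last exact: dev.
  apply: ereal_sup_ubound; exists (cubep c) => //.
  by split => //; exact: is_cube_cube.
move: W_le U_le W0; rewrite -(fineK fin) -EFinM -EFinD.
case: W => [v| |]//; rewrite !lee_fin -?EFinD ?lee_fin => h1 h2 _.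
by split => //; rewrite ler_norml; apply/andP; split; lra.
Qed.

End at_point.
End commutator_bound.

(** * Pointwise bound and boundedness of the commutator *)

Section main_bound.
Context {R : realType} {n : nat}.
Local Notation V := 'rV[R]_n.+1.
Local Notation T := (Rn R n).
Local Notation leb := (@lebn R n).
Local Notation cubep c := (cube c.1 c.2 : set T).
Local Notation volume := (@volume R n).

Context (w : T -> R) (w_weight : is_weight w) (C : R) (C_ge1 : 1 <= C)
  (w_a1 : {ae leb, forall x, a1_point C w x}).

Let w_ge0 x : 0 <= w x. Proof. by case: w_weight. Qed.
Let C_gt0 : 0 < C. Proof. exact: lt_le_trans ltr01 C_ge1. Qed.

Context (b : T -> R) (b_loc : locally_integrable_n b) (al D : R)
  (al_gt0 : 0 < al) (D_ge0 : 0 <= D).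
Context (b_lip : {ae leb, forall x, lip_point w b al D x}).
Context (p q : R) (p_gt1 : 1 < p) (q_gt0 : 0 < q) (pq : q^-1 = p^-1 - al).

Let p_gt0 : 0 < p. Proof. exact: lt_trans ltr01 p_gt1. Qed.

(** Raised to the power q, the exponent 1 - p al of M_mu f becomes p. *)
Let pal : 1 - p * al = p / q.
Proof. by rewrite pq mulrBr divff ?gt_eqF. Qed.

Let pal_lt1 : p * al < 1.
Proof. by rewrite -subr_gt0 pal divr_gt0. Qed.

Section at_point.
Context (f : T -> R) (mf : measurable_fun setT f) (F : R) (F_gt0 : 0 < F)
  (fF : (\int[leb]_x (`|f x| `^ p * w x)%:E <= F%:E)%E).
Context (x : T) (xa : a1_point C w x) (xl : lip_point w b al D x)
  (bx0 : 0 <= b x) (v : R) (xv : weighted_maximal w f x = v%:E).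

Let weighted_average_le (c : V * R) : 0 < c.2 -> cubep c x ->
  exists i : R, [/\ weighted_integral w f (cubep c) = i%:E, 0 <= i,
    i / mass w c <= v & i <= 2 * F `^ p^-1 * mass w c `^ (1 - p^-1)].
Proof.
move=> c0 cx.
have := weighted_integral_holder w_weight C_ge1 w_a1 mf p_gt1 F_gt0 fF c0.
have := weighted_integral_ge0 w_weight f (cubep c).
have : (weighted_integral w f (cubep c) * ((mass w c)^-1)%:E <= v%:E)%E.
  by rewrite -xv; apply: ereal_sup_ubound; exists c.
case: (weighted_integral w f (cubep c)) => [i| |]//; rewrite !lee_fin => h1 h2 h3.
by exists i.
Qed.

Definition pointwise_bound : R :=
  2 * D * C * w x * (v `^ (1 - p * al) * (2 * F `^ p^-1) `^ (p * al)).

Lemma commutator_pointwise :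
  commutator_maximal b f x \is a fin_num /\
  (`|commutator_maximal b f x| <= pointwise_bound%:E)%E.
Proof.
have k0 : 0 <= 2 * D * C * w x.
  by rewrite mulr_ge0// mulr_ge0 ?(ltW C_gt0)// mulr_ge0.
apply: (commutator_le w_weight b_loc mf bx0) => //.
- by rewrite mulr_ge0// mulr_ge0 ?powR_ge0.
- have x1 : [set Q : set T | is_cube Q /\ Q x] (cube x 1).
    by split; [exists x, 1|exact: cube_nonempty].
  have U0 : (0 <= maximal f x)%E.
    apply: le_trans (ereal_sup_ubound (imageP _ x1)).
    exact: (@cube_abs_mean_ge0 _ _ _ w_weight _ (x : V, 1)).
  (* A_1 bounds plain averages of |f| by C times weighted ones, so M f (x) is at most C v. *)
  rewrite ge0_fin_numE//; apply: (@le_lt_trans _ _ (C * v)%:E); last exact: ltry.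
  apply: ge_ereal_sup => _ [_ [/is_cubeP[c c0 ->] cx] <-].
  have [i [iE i0 iv _]] := weighted_average_le c0 cx.
  have vol0 := volume_gt0 w_weight c0.
  have m0 := mass_gt0 w_weight C_ge1 w_a1 c0.
  rewrite (cube_abs_meanE w_weight)// lee_pdivrMl//.
  apply: le_trans (integral_le_weighted w_weight C_ge1 w_a1 mf c0) _.
  rewrite iE -!EFinM lee_fin.
  rewrite [leLHS](_ : _ = volume c.2 * (C * (i / mass w c))); last by ring.
  by rewrite ler_pM2l// ler_pM2l.
- move=> c c0 cx.
  apply: le_trans (mean_dev_le w_weight C_ge1 w_a1 b_loc D_ge0 b_lip mf xa xl c0 cx) _.
  have [i [-> i0 iv iF]] := weighted_average_le c0 cx.
  have m0 := mass_gt0 w_weight C_ge1 w_a1 c0.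
  rewrite -EFinM lee_fin.
  have h := hedberg_interpolation i0 m0 p_gt0 al_gt0 pal_lt1 iv iF.
  by have := ler_wpM2l k0 h; rewrite [leLHS]mulrA.
Qed.

Definition norm_factor : R := (2 * D * C * 2 `^ (p * al)) `^ q.

(** The q-th power of the pointwise bound contains w(x)^q, and w(x)^q w(x)^(1-q) = w(x) because w(x)
    > 0. *)
Lemma commutator_pointwise_powR : 0 < w x ->
  (`|commutator_maximal b f x| `^ q * (w x `^ (1 - q))%:E <=
    (norm_factor * F `^ (al * q) * (v `^ p * w x))%:E)%E.
Proof.
move=> wx0; have [_ h] := commutator_pointwise.
have -> : norm_factor * F `^ (al * q) * (v `^ p * w x) =
    pointwise_bound `^ q * w x `^ (1 - q).
  have -> : pointwise_bound = 2 * D * C * 2 `^ (p * al) * w x *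
      v `^ (1 - p * al) * F `^ al.
    rewrite /pointwise_bound (@powRM _ 2 (F `^ p^-1))// ?powR_ge0// -powRrM.
    by rewrite mulKf ?gt_eqF//; ring.
  have k0 : 0 <= 2 * D * C * 2 `^ (p * al).
    by rewrite mulr_ge0 ?powR_ge0// mulr_ge0 ?(ltW C_gt0)// mulr_ge0.
  have kw0 := mulr_ge0 k0 (w_ge0 x).
  have kv0 := mulr_ge0 kw0 (powR_ge0 v (1 - p * al)).
  rewrite (powRM _ kv0 (powR_ge0 _ _)) (powRM _ kw0 (powR_ge0 _ _)) (powRM _ k0 (w_ge0 x)).
  rewrite -/norm_factor -!powRrM pal divfK ?gt_eqF//.
  have {1}-> : w x = w x `^ q * w x `^ (1 - q).
    by rewrite -powRD ?(gt_eqF wx0) ?implybT// addrC subrK powRr1// ltW.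
  by ring.
rewrite EFinM; apply: lee_wpmul2r; first by rewrite lee_fin powR_ge0.
rewrite -poweR_EFin; apply: (gt0_ler_poweR (ltW q_gt0) _ _ h).
  by rewrite in_itv/= leey andbT.
by rewrite in_itv/= leey andbT; apply: le_trans h.
Qed.

End at_point.

Lemma bounded_of_lipschitz : {ae leb, forall x, 0 <= b x} ->
  bounded_operator (commutator_maximal b) p w q (fun x => w x `^ (1 - q)).
Proof.
move=> b_ge0.
have [K [K0 strong]] := weighted_maximal_strong_type w_weight C_ge1 w_a1 p_gt1.
have N0 : 0 <= norm_factor by exact: powR_ge0.
(* The + 1 makes the constant strictly positive. *)
exists ((norm_factor * K) `^ q^-1 + 1); split; first by rewrite ltr_wpDl ?powR_ge0.
move=> f [mf]; rewrite {1}/weighted_norm.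
have XE : (\int[leb]_x (`|(EFin \o f) x| `^ p * (w x)%:E) =
    \int[leb]_x (`|f x| `^ p * w x)%:E)%E.
  by apply: eq_integral => x _; rewrite [(_ \o _) x]/= abse_EFin poweR_EFin -EFinM.
have X0 : (0 <= \int[leb]_x (`|f x| `^ p * w x)%:E)%E.
  by apply: integral_ge0 => x _; rewrite lee_fin mulr_ge0 ?powR_ge0.
have pV0 : p^-1 != 0 by rewrite gt_eqF// invr_gt0.
rewrite XE => /(lty_poweRy pV0) X_lty.
have [F [XF F0]] : exists F : R,
    (\int[leb]_x (`|f x| `^ p * w x)%:E = F%:E)%E /\ 0 <= F.
  exists (fine (\int[leb]_x (`|f x| `^ p * w x)%:E)%E); split; last exact: fine_ge0.
  by rewrite fineK// ge0_fin_numE.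
(* Hölder's optimization needs a positive bound on the integral of |f|^p w. If that integral is 0,
   the bound 1 is taken, and the factor [F] in the integrated estimate still makes the result
   zero. *)
pose F1 := if F == 0 then 1 else F.
have F1_gt0 : 0 < F1.
  by rewrite /F1; case: eqVneq => // Fn0; rewrite lt_neqAle eq_sym Fn0.
have fF1 : (\int[leb]_x (`|f x| `^ p * w x)%:E <= F1%:E)%E.
  by rewrite XF lee_fin /F1; case: eqVneq => [->|].
have [Phi [mPhi Phi0 Phi_ge Phi_le]] := strong f mf.
(* [Phi] is integrable, hence finite almost everywhere; as w > 0 almost everywhere, M_mu f is then
   finite almost everywhere too. *)
have Phi_fin : {ae leb, forall x, setT x -> Phi x \is a fin_num}.
  apply: (integrable_ae (measurableT : measurable [set: T])).
  apply/integrableP; split => //.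
  rewrite (eq_integral Phi); last by move=> x _; rewrite gee0_abs.
  by apply: le_lt_trans Phi_le _; rewrite XF -EFinM ltry.
have good : {ae leb, forall x, commutator_maximal b f x \is a fin_num /\
    (`|commutator_maximal b f x| `^ q * (w x `^ (1 - q))%:E <=
      (norm_factor * F1 `^ (al * q))%:E * Phi x)%E}.
  have ae1 : {ae leb, forall x, [/\ a1_point C w x, lip_point w b al D x & 0 <= b x]}.
    by apply: filterS3 w_a1 b_lip b_ge0.
  have w_gt0 := weight_gt0 w_weight C_ge1 w_a1.
  apply: filterS3 ae1 w_gt0 Phi_fin => x [xa xl bx0] wx0 /(_ I) Phix.
  have [v xv] : exists v : R, weighted_maximal w f x = v%:E.
    have := Phi_ge x.
    have : (0 <= weighted_maximal w f x)%E.
      have x1 : [set c : V * R | 0 < c.2 /\ cubep c x] (x : V, 1).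
        by split=> //; exact: cube_nonempty.
      apply: le_trans (ereal_sup_ubound (imageP _ x1)).
      by rewrite mule_ge0 ?weighted_integral_ge0// lee_fin invr_ge0 mass_ge0.
    case: (weighted_maximal w f x) => [v| |]// _; first by exists v.
    rewrite poweRyr ?gt_eqF// gt0_mulye ?lte_fin// leye_eq => /eqP PhiE.
    by rewrite PhiE in Phix.
  have [cfin _] := commutator_pointwise mf F1_gt0 fF1 xa xl bx0 xv.
  split => //; apply: le_trans (commutator_pointwise_powR mf F1_gt0 fF1 xa xl bx0 xv wx0) _.
  rewrite EFinM; apply: lee_wpmul2l; first by rewrite lee_fin mulr_ge0 ?powR_ge0.
  by have := Phi_ge x; rewrite xv poweR_EFin -EFinM.
split; first by apply: filterS good => x [].
have k0 : (0 <= (norm_factor * F1 `^ (al * q))%:E)%E.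
  by rewrite lee_fin mulr_ge0 ?powR_ge0.
have S_le : (\int[leb]_x (`|commutator_maximal b f x| `^ q * (w x `^ (1 - q))%:E) <=
    (norm_factor * F1 `^ (al * q) * (K * F))%:E)%E.
  apply: (@le_trans _ _ (\int[leb]_x ((norm_factor * F1 `^ (al * q))%:E * Phi x))%E).
    apply: ae_le_integral_nonmeasurable.
    - by move=> x; rewrite mule_ge0 ?poweR_ge0// lee_fin powR_ge0.
    - by move=> x; rewrite mule_ge0.
    - exact: emeasurable_funM (measurable_cst _) mPhi.
    - by apply: filterS good => x [].
  rewrite (ge0_integralZl _ measurableT mPhi (fun x _ => Phi0 x) k0) [leRHS]EFinM.
  by apply: (lee_wpmul2l k0); rewrite EFinM -XF.
rewrite /weighted_norm XE XF.
have qV0 : 0 <= q^-1 by rewrite invr_ge0 ltW.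
apply: (@le_trans _ _ ((norm_factor * F1 `^ (al * q) * (K * F))%:E `^ q^-1)%E).
  apply: (gt0_ler_poweR qV0 _ _ S_le).
    rewrite in_itv/= leey andbT; apply: integral_ge0 => x _.
    by rewrite mule_ge0 ?poweR_ge0// lee_fin powR_ge0.
  by rewrite in_itv/= leey andbT lee_fin mulr_ge0 ?mulr_ge0 ?powR_ge0.
rewrite !poweR_EFin -EFinM lee_fin.
apply: (@le_trans _ _ ((norm_factor * K) `^ q^-1 * F `^ p^-1)); last first.
  by apply: ler_wpM2r; rewrite ?powR_ge0// lerDl.
have NK0 : 0 <= norm_factor * K by exact: mulr_ge0.
have FF0 : 0 <= F1 `^ (al * q) * F by rewrite mulr_ge0 ?powR_ge0.
rewrite mulrACA (powRM _ NK0 FF0); apply: ler_wpM2l; first exact: powR_ge0.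
rewrite /F1; case: eqVneq => [->|Fn0].
  have qVn0 : q^-1 != 0 by rewrite invr_eq0 gt_eqF.
  by rewrite mulr0 !powR0.
(* The exponents add up: (al q + 1) / q = al + 1/q = 1/p. *)
rewrite -{2}(powRr1 F0) -powRD ?Fn0 ?implybT// -powRrM mulrDl mul1r mulfK ?gt_eqF//.
by rewrite pq addrC subrK.
Qed.

End main_bound.

(** * Assembly of the equivalence *)

Lemma muckenhoupt_a1_point (R : realType) (n : nat) (w : Rn R n -> R) :
  muckenhoupt_A1 w ->
  exists C : R, 1 <= C /\ {ae @lebn R n, forall x, a1_point C w x}.
Proof.
move=> [w_weight [C0 w_max]]; have [_ w_ge0 _] := w_weight.
(* The constant is enlarged to at least 1, which puts [a1_ratio] strictly between 0 and 1. *)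
exists (Num.max 1 C0); split; first by rewrite le_max lexx.
apply: filterS w_max => x xmax c c0 cx.
have v0 := volume_gt0 w_weight c0.
have : (cube_abs_mean w (cube c.1 c.2) <= maximal w x)%E.
  apply: ereal_sup_ubound; exists (cube c.1 c.2) => //.
  by split => //; exact: is_cube_cube.
move=> /le_trans /(_ xmax).
rewrite (cube_abs_meanE w_weight)//.
have -> : (\int[@lebn R n]_(y in cube c.1 c.2) `|w y|%:E = (mass w c)%:E)%E.
  transitivity (weight_measure w (cube c.1 c.2)); last by rewrite weight_measure_cube.
  by apply: eq_integral => y _; rewrite ger0_norm.
rewrite -!EFinM lee_fin ler_pdivrMl// => h; apply: le_trans h _.
rewrite mulrC; apply: ler_wpM2r; first exact: ltW.
by apply: ler_wpM2r => //; rewrite le_max lexx orbT.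
Qed.

Theorem theorem1p2 (R : realType) (n : nat) (b mu : Rn R n -> R)
    (beta p q : R)
    (hb : locally_integrable_n b) (hmu : muckenhoupt_A1 mu)
    (hbeta : 0 < beta < 1)
    (hp : 1 < p < n.+1%:R / beta)
    (hq : q^-1 = p^-1 - beta / n.+1%:R) :
  [<-> weighted_lip beta mu b /\ {ae @lebn R n, forall x, 0 <= b x};
       bounded_operator (commutator_maximal b)
         p mu q (fun x => mu x `^ (1 - q));
       exists C : R, 0 < C /\
         (ereal_sup [set (weight_measure mu Q `^ (beta / n.+1%:R))^-1 *
            ((weight_measure mu Q)^-1 *
             \int[@lebn R n]_(x in Q)
               (`|(b x)%:E - local_maximal Q b x| `^ q *
                (mu x `^ (1 - q))%:E)) `^ q^-1 | Q in is_cube]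
          <= C%:E)%E].
Proof.
have [C [C1 mu_a1]] := muckenhoupt_a1_point hmu.
have mu_weight : is_weight mu by case: hmu.
have /andP[beta0 beta1] := hbeta; have /andP[p1 pn] := hp.
set al := beta / n.+1%:R in hq *.
have al0 : 0 < al by rewrite divr_gt0.
have p0 : 0 < p := lt_trans ltr01 p1.
have q0 : 0 < q.
  rewrite -invr_gt0 hq subr_gt0 -[al]invrK ltf_pV2 ?posrE ?invr_gt0//.
  by rewrite invf_div.
have q1 : 1 < q.
  rewrite -(invf_lt1 q0) hq; apply: (@lt_trans _ _ p^-1); last by rewrite invf_lt1.
  by rewrite ltrBlDr ltrDl.
tfae.
- move=> [[_ lip] b_ge0].
  have [K0 [K00 lipK]] : exists K0 : R, 0 <= K0 /\ forall c : 'rV[R]_n.+1 * R,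
      0 < c.2 -> (\int[@lebn R n]_(x in cube c.1 c.2)
          `|b x - cube_mean b (cube c.1 c.2)|%:E <=
        (K0 * (mass mu c * mass mu c `^ al))%:E)%E.
    have m0 := mass_gt0 mu_weight C1 mu_a1.
    have lip_le (c : 'rV[R]_n.+1 * R) : 0 < c.2 ->
        (((mass mu c `^ (1 + al))^-1)%:E * \int[@lebn R n]_(x in cube c.1 c.2)
          `|b x - cube_mean b (cube c.1 c.2)|%:E <= lip_seminorm beta mu b)%E.
      move=> c0; apply: ereal_sup_ubound; exists (cube c.1 c.2).
        exact: is_cube_cube.
      rewrite weight_measure_cube// -surjective_pairing poweR_EFin inver.
      by rewrite gt_eqF// powR_gt0// m0.
    have lip0 : (0 <= lip_seminorm beta mu b)%E.
      apply: le_trans (lip_le (0, 1) ltr01).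
      by rewrite mule_ge0 ?lee_fin ?invr_ge0 ?powR_ge0// integral_ge0.
    exists (fine (lip_seminorm beta mu b)); split; first exact: fine_ge0.
    move=> c c0; have := lip_le c c0; rewrite lee_pdivrMl ?powR_gt0 ?m0//.
    move=> /le_trans; apply; rewrite EFinM fineK ?ge0_fin_numE// muleC.
    rewrite powRD; last by rewrite (gt_eqF (m0 _ c0)) implybT.
    by rewrite powRr1 ?mass_ge0.
  have D0 : 0 <= @lip_constant R n C al K0.
    rewrite mulr_ge0 ?powR_ge0// mulr_ge0// lip_factor_ge0//.
  apply: (bounded_of_lipschitz mu_weight C1 mu_a1 hb al0 D0) => //.
  exact: (ae_lip_pointwise mu_weight C1 mu_a1 hb al0 K00 lipK).
- move=> /(testing_of_bounded mu_weight C1 mu_a1 hb p0 q0 hq)[C0 [C00 h]].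
  exists C0; split => //; apply: ge_ereal_sup => _ [_ /is_cubeP[c c0 ->] <-].
  exact: h.
- move=> [C0 [C00 h]].
  have testing (c : 'rV[R]_n.+1 * R) : 0 < c.2 ->
      (((weight_measure mu (cube c.1 c.2) `^ al)^-1 *
        ((weight_measure mu (cube c.1 c.2))^-1 *
         testing_integral mu b q (cube c.1 c.2)) `^ q^-1) <= C0%:E)%E.
    move=> c0; apply: le_trans h; apply: ereal_sup_ubound.
    by exists (cube c.1 c.2) => //; exact: is_cube_cube.
  split; last exact: (testing_nonneg mu_weight C1 mu_a1 hb al0 q1 C00 testing).
  have [K lipK] := testing_lipschitz mu_weight C1 mu_a1 hb q1 C00 testing.
  split => //; apply: (@le_lt_trans _ _ K%:E); last exact: ltry.
  by apply: ge_ereal_sup => _ [Q Qc <-]; exact: lipK.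
Qed.
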